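(* Let $S\subseteq\mathbb{N}$ be any set of positive integers. Then there is a finite subset $S_0\subseteq S$ such that every sum of triangular numbers $f$ satisfies: $f$ represents $S$ if and only if $f$ represents $S_0$.
   Context: For an integer $x\ge 0$, $T_x:=\frac{x(x+1)}{2}$ is the $x$-th triangular number (with $T_0=0$ included). A sum of triangular numbers is a form $f(x)=f_b(x)=\sum_{i=1}^k b_iT_{x_i}$, where $k\ge 1$ and $b_1\le\dots\le b_k$ are positive integers. $f$ represents an integer $n$ if $n=\sum_{i=1}^k b_iT_{x_i}$ for some nonnegative integers $x_1,\dots,x_k$; $f$ represents a set $A$ if it represents every element of $A$. The set $S_0$ depends only on $S$, not on $f$. *)

(* Defs.v *)
From mathcomp Require Import all_boot.
From mathcomp Require Import classical_sets cardinality.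

Set Implicit Arguments.
Unset Strict Implicit.
Unset Printing Implicit Defensive.

Definition triangular (x : nat) : nat := (x * (x + 1)) %/ 2.

(* The form \sum_i b_i T_{x_i} is encoded by its coefficient tuple [b]. *)
Definition triangular_form (k : nat) (b : k.-tuple nat) : Prop :=
  [/\ 1 <= k,
      forall i : 'I_k, 0 < tnth b i
    & forall i j : 'I_k, i <= j -> tnth b i <= tnth b j].

Definition represents (k : nat) (b : k.-tuple nat) (n : nat) : Prop :=
  exists x : k.-tuple nat, n = \sum_(i < k) tnth b i * triangular (tnth x i).

Definition represents_set (k : nat) (b : k.-tuple nat) (A : set nat) : Prop :=
  forall n : nat, A n -> represents b n.

(* Main.v *)
Require Import Defs.
From mathcomp Require Import all_boot all_algebra cyclic.
From mathcomp Require Import zify ring.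
From mathcomp Require Import boolp classical_sets cardinality.

(* If no finite subset of [S] works, then forms that fail to represent [S] can be extended for ever,
   each time by coefficients making a new element of [S] represented; this yields an infinite sequence
   of coefficients, and it suffices to show that finitely many of them already represent everything
   that all of them represent.
     The main point is that finitely many terms of any infinite sequence represent all large
   multiples of some [M]. By Cauchy-Schwarz, five terms represent a positive proportion of the
   multiples of [M], uniformly in [M]. Adding further terms one at a time, the density must
   eventually stay almost constant; then the set [G] reached is nearly invariant under the shifts
   by the values of the next term, whose differences contain all even numbers, so that [G] almost
   fills an interval. Another five terms of positive density fill the gaps, and two more terms
   bring any large number into that interval.
     What remains is to represent modulo [M], by the first terms, whatever the whole sequence
   represents. This is a question modulo prime powers: for odd [p], among [p] coefficients with the
   same class modulo squares of p-adic numbers one can either solve for a single variable by Hensel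
   lifting, or obtain all multiples of a fixed power of [p]. *)

Set Implicit Arguments.
Unset Strict Implicit.
Unset Printing Implicit Defensive.

Import GRing.Theory Num.Theory.

(** * Counting *)

Lemma leq_sum_inj (A B : finType) (F : A -> B) (g : B -> nat) :
  injective F -> \sum_(x : A) g (F x) <= \sum_(y : B) g y.
Proof.
move=> Finj.
rewrite -(big_imset g (h := F) (A := predT)) /=; last by move=> x y _ _; apply: Finj.
by rewrite [leqRHS](bigID (mem (imset F (mem predT)))) /= leq_addr.
Qed.

Lemma sum_bool_card (A : finType) (P : pred A) : \sum_(x : A) P x = #|P|.
Proof. by rewrite -sum1_card [RHS]big_mkcond; apply: eq_bigr => x _; rewrite unfold_in; case: (P x). Qed.

Lemma leq_card_inj_on (A B : finType) (P : pred A) (Q : pred B) (f : A -> B) :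
  {in P &, injective f} -> (forall x, P x -> Q (f x)) -> #|P| <= #|Q|.
Proof.
move=> finj fPQ; rewrite -(card_in_imset finj); apply/subset_leq_card/fintype.subsetP => y.
by case/imsetP => x Px ->; apply: fPQ.
Qed.

Lemma leq_card_code (A : finType) (P : pred A) (n : nat) (f : A -> nat) :
  {in P &, injective f} -> (forall x, P x -> f x < n) -> #|P| <= n.
Proof.
case: n => [|n] finj fPn.
  by rewrite leqn0; apply/eqP/eq_card0 => x; apply/negP => /fPn.
rewrite -[n.+1]card_ord; apply: (leq_card_inj_on (Q := predT) (f := fun x => inord (f x) : 'I_n.+1)) => //.
by move=> x y Px Py /(congr1 val)/=; rewrite !inordK ?fPn //; apply: finj.
Qed.

(** The products [b * x] lie in one residue class modulo [m], so the quotient of [b * x] by [m]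
    determines [x]. *)
Lemma card_linear_congr (Z b m : nat) (P : pred 'I_Z) :
  0 < b -> 0 < m ->
  (forall x y : 'I_Z, P x -> P y -> b * x = b * y %[mod m]) ->
  #|P| <= (b * Z) %/ m + 1.
Proof.
move=> b0 m0 congP.
apply: (leq_card_code (f := fun x : 'I_Z => (b * x) %/ m)) => [x y Px Py exy|x _].
  apply/val_inj/eqP; rewrite /= -(eqn_pmul2l b0).
  by rewrite (divn_eq (b * x) m) (divn_eq (b * y) m) exy (congP x y).
by rewrite addn1 ltnS leq_div2r // leq_mul2l ltnW ?orbT.
Qed.

Lemma cauchy_schwarz_nat (A : finType) (V : {set A}) (r : A -> nat) :
  (\sum_(x in V) r x) ^ 2 <= #|V| * \sum_(x in V) r x ^ 2.
Proof.
have E (F : A -> nat) : #|V| * \sum_(x in V) F x = \sum_(y in V) \sum_(x in V) F x.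
  by rewrite sum_nat_const.
rewrite -(leq_pmul2l (isT : 0 < 2)) -mulnn big_distrlr /= big_distrr /=.
rewrite mul2n -addnn {1}E {1}E [X in _ <= _ + X]exchange_big -big_split /=.
apply: leq_sum => y _; rewrite -big_split big_distrr /=.
by apply: leq_sum => x _; rewrite addnC; exact: (nat_Cauchy _ _).
Qed.

(** Cauchy-Schwarz for the fibre sizes [r v]: they add up to [#|A|], and their squares add up to the
    number of coinciding pairs. *)
Lemma image_energy (A : finType) (X : nat) (f : A -> 'I_X) :
  #|A| ^ 2 <= #|[set f x | x in A]| * \sum_(p : A * A) (f p.1 == f p.2).
Proof.
set V := [set f x | x in A].
pose r (v : 'I_X) := \sum_(x : A) (f x == v).
have -> : #|A| = \sum_(v in V) r v.
  rewrite /r exchange_big /= -sum1_card; apply: eq_bigr => x _.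
  by rewrite (bigD1 (f x)) ?imset_f //= eqxx big1 ?addn0 // => v /andP[_ /negbTE]; rewrite eq_sym => ->.
have -> : \sum_(p : A * A) (f p.1 == f p.2) = \sum_(v in V) r v ^ 2.
  rewrite -(pair_bigA _ (fun x y => (f x == f y : nat))) /=.
  under [RHS]eq_bigr do rewrite -mulnn big_distrlr /=.
  rewrite [RHS]exchange_big; apply: eq_bigr => x _; rewrite [RHS]exchange_big; apply: eq_bigr => y _ /=.
  rewrite (bigD1 (f x)) ?imset_f //= eqxx mul1n big1 ?addn0 1?eq_sym // => v /andP[_ /negbTE].
  by rewrite eq_sym => ->.
exact: cauchy_schwarz_nat.
Qed.

(** * Counting by heights *)

(* The height of the fraction [h0 / h1]; it is [0] exactly when [h0 = h1 = 0]. *)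
Definition height (h0 h1 : int) : nat := maxn `|h0| `|h1| %/ gcdn `|h0| `|h1|.

Lemma heightC (h0 h1 : int) : height h0 h1 = height h1 h0.
Proof. by rewrite /height maxnC gcdnC. Qed.

Lemma height_eq0 (h0 h1 : int) : height h0 h1 = 0 -> h0 = 0%R /\ h1 = 0%R.
Proof.
move=> /eqP; rewrite /height; have [g0|g0] := posnP (gcdn `|h0| `|h1|).
  have := dvdn_gcdl `|h0| `|h1|; have := dvdn_gcdr `|h0| `|h1|.
  by rewrite g0 !dvd0n !absz_eq0 => /eqP-> /eqP->.
rewrite -leqn0 leqNgt divn_gt0 // leq_max.
have [/eqP|h0_gt0] := posnP `|h0|; last by rewrite dvdn_leq ?dvdn_gcdl.
rewrite absz_eq0 => /eqP->; have [/eqP|h1_gt0] := posnP `|h1|; last by rewrite gcd0n leqnn orbT.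
by rewrite absz_eq0 => /eqP->.
Qed.

(** Dividing by the gcd leaves coprime [u0], [u1] with [|u0|] the height. Then [b1 * x.2] is fixed
    modulo [|u0|], and [x.2] determines [x.1] because [h0] is nonzero. As [|u0| <= Z], the extra [1]
    in the count is harmless. *)
Lemma card_linear_pair_half (b0 b1 Z : nat) (h0 h1 : int) (P : pred ('I_Z * 'I_Z)) :
  0 < b0 -> 0 < b1 -> h0 != 0%R -> `|h1| <= `|h0| <= Z ->
  (forall x y, P x -> P y ->
     (b0%:Z * h0 * (x.1%:Z - y.1%:Z) + b1%:Z * h1 * (x.2%:Z - y.2%:Z))%R = 0%R) ->
  #|P| * height h0 h1 <= (b0 + b1 + 1) * Z.
Proof.
move=> b0_gt0 b1_gt0 h0n0 /andP[h10 h0Z] eqP0.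
have h0_gt0 : 0 < `|h0| by rewrite absz_gt0.
set g := gcdz h0 h1.
have gn0 : g != 0%R by rewrite gcdz_eq0 negb_and h0n0.
have [u0 Eu0] : exists u0 : int, h0 = (u0 * g)%R by exists (h0 %/ g)%Z; rewrite divzK ?dvdz_gcdl.
have [u1 Eu1] : exists u1 : int, h1 = (u1 * g)%R by exists (h1 %/ g)%Z; rewrite divzK ?dvdz_gcdr.
have cop : coprimez u0 u1.
  have : gcdn `|u0| `|u1| * `|g| = `|g|.
    by rewrite muln_gcdl -!abszM -Eu0 -Eu1.
  by move/eqP; rewrite -{2}[`|g|]mul1n eqn_pmul2r ?absz_gt0.
have u0_gt0 : 0 < `|u0| by rewrite absz_gt0; apply: contra h0n0 => /eqP u00; rewrite Eu0 u00 mul0r.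
have Eh : height h0 h1 = `|u0|.
  rewrite /height (maxn_idPl h10); have -> : gcdn `|h0| `|h1| = `|g| by [].
  by rewrite {1}Eu0 abszM mulnK // absz_gt0.
have u0Z : `|u0| <= Z.
  by apply: leq_trans h0Z; rewrite Eu0 abszM leq_pmulr // absz_gt0.
pose Q := [pred z1 : 'I_Z | [exists z0, P (z0, z1)]].
have PQ : #|P| <= #|Q|.
  apply: (leq_card_inj_on (f := snd)) => [x y Px Py exy|[z0 z1] Pz]; last by apply/existsP; exists z0.
  have := eqP0 x y Px Py; rewrite exy subrr mulr0 addr0 => /eqP.
  rewrite !mulf_eq0 (negbTE h0n0) orbF subr_eq0 => /orP[/eqP|/eqP E]; first by lia.
  by case: x y {Px Py} exy E => [x0 x1] [y0 y1] /= -> [E]; congr pair; apply: val_inj.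
have Qc : #|Q| <= (b1 * Z) %/ `|u0| + 1.
  apply: card_linear_congr => // x1 y1 /existsP[x0 Px] /existsP[y0 Py].
  have := eqP0 _ _ Px Py; rewrite /= {1}Eu0 {1}Eu1.
  have -> : (b0%:Z * (u0 * g) * (x0%:Z - y0%:Z) + b1%:Z * (u1 * g) * (x1%:Z - y1%:Z) =
    g * (u0 * (b0%:Z * (x0%:Z - y0%:Z)) + u1 * (b1%:Z * x1%:Z - b1%:Z * y1%:Z)))%R by ring.
  move/eqP; rewrite mulf_eq0 (negbTE gn0) /= addr_eq0 => /eqP E.
  have : (u0 %| (u1 * (b1%:Z * x1%:Z - b1%:Z * y1%:Z))%R)%Z.
    by rewrite -[X in (_ %| X)%Z]opprK -E -mulrN dvdz_mulr.
  rewrite (Gauss_dvdzr _ cop) -(eqz_mod_dvd u0 (b1%:Z * x1%:Z)%R (b1%:Z * y1%:Z)%R) -!PoszM.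
  by rewrite -[X in X == _]modz_abs -[X in _ == X]modz_abs !modz_nat => /eqP[].
rewrite Eh; apply: leq_trans (leq_mul (leq_trans PQ Qc) (leqnn _)) _.
rewrite mulnDl mul1n; have := leq_trunc_div (b1 * Z) `|u0|; nia.
Qed.

Lemma card_linear_pair (b0 b1 Z : nat) (h0 h1 : int) (P : pred ('I_Z * 'I_Z)) :
  0 < b0 -> 0 < b1 -> `|h0| <= Z -> `|h1| <= Z ->
  (forall x y, P x -> P y ->
     (b0%:Z * h0 * (x.1%:Z - y.1%:Z) + b1%:Z * h1 * (x.2%:Z - y.2%:Z))%R = 0%R) ->
  #|P| * height h0 h1 <= (b0 + b1 + 1) * Z.
Proof.
move=> b0_gt0 b1_gt0 h0Z h1Z eqP0.
have [h10|/ltnW h01] := leqP `|h1| `|h0|.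
  have [h00|h0n0] := eqVneq h0 0%R; last by apply: card_linear_pair_half => //; rewrite h10.
  have h1E : h1 = 0%R by move: h10; rewrite h00; lia.
  by rewrite /height h00 h1E muln0.
have [h1E|h1n0] := eqVneq h1 0%R.
  have h0E : h0 = 0%R by move: h01; rewrite h1E; lia.
  by rewrite /height h1E h0E muln0.
pose P' (x : 'I_Z * 'I_Z) := P (x.2, x.1).
have -> : #|P| = #|P'|.
  apply/eqP; rewrite eqn_leq; apply/andP; split.
    by apply: (leq_card_inj_on (f := fun x => (x.2, x.1))) => [[? ?] [? ?] _ _ [-> ->]//|[]].
  by apply: (leq_card_inj_on (f := fun x => (x.2, x.1))) => [[? ?] [? ?] _ _ [-> ->]//|[]].
rewrite heightC [b0 + b1]addnC; apply: card_linear_pair_half => //; first by rewrite h01.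
by move=> [x1 x0] [y1 y0] Px Py; rewrite addrC; apply: (eqP0 (x0, x1) (y0, y1)).
Qed.

Lemma card_height_le (Z t : nat) : 0 < Z -> 0 < t ->
  #|[pred h : 'I_(2 * Z) * 'I_(2 * Z) | height (h.1%:Z - Z%:Z)%R (h.2%:Z - Z%:Z)%R <= t]| <= 64 * Z * t.
Proof.
move=> Z0 t0.
pose n (h : 'I_(2 * Z) * 'I_(2 * Z)) := maxn `|(h.1%:Z - Z%:Z)%R| `|(h.2%:Z - Z%:Z)%R|.
pose m (h : 'I_(2 * Z) * 'I_(2 * Z)) := minn `|(h.1%:Z - Z%:Z)%R| `|(h.2%:Z - Z%:Z)%R|.
pose g h := gcdn (n h) (m h).
pose u h := n h %/ g h.
pose v h := m h %/ g h.
have gE h : g h = gcdn `|(h.1%:Z - Z%:Z)%R| `|(h.2%:Z - Z%:Z)%R|.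
  rewrite /g /n /m; case: (leqP `|(h.1%:Z - Z%:Z)%R| `|(h.2%:Z - Z%:Z)%R|) => //.
  by move=> _; rewrite gcdnC.
have uE h : u h = height (h.1%:Z - Z%:Z)%R (h.2%:Z - Z%:Z)%R by rewrite /u gE.
have nE h : n h = u h * g h by rewrite divnK ?dvdn_gcdl.
have mE h : m h = v h * g h by rewrite divnK ?dvdn_gcdr.
have vu h : v h <= u h by apply: leq_div2r; rewrite geq_min leq_max leqnn.
have nZ h : n h <= Z by rewrite /n; have := ltn_ord h.1; have := ltn_ord h.2; lia.
have un h : u h <= n h by apply: leq_div.
have gn h : g h <= n h.
  have [n0|n0] := posnP (n h); last by rewrite dvdn_leq ?dvdn_gcdl.
  by move: (vu h); rewrite /g n0 gcd0n; have := geq_minl `|(h.1%:Z - Z%:Z)%R| `|(h.2%:Z - Z%:Z)%R|;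
     rewrite -/(m h); move: n0; rewrite /n; lia.
(* Since [v h <= u h], division of [w h] by [(u h).+1] recovers both [g h] and [v h]. Thus
   [u h <= t], [w h <= 3 * Z] and three bits for signs and order determine the pair. *)
pose w h := g h * (u h).+1 + v h.
have wlt h : w h < (3 * Z).+1 by rewrite /w mulnS mulnC -nE; move: (vu h) (un h) (gn h) (nZ h); lia.
pose code (h : 'I_(2 * Z) * 'I_(2 * Z)) := ((h.1 < Z, h.2 < Z, `|(h.1%:Z - Z%:Z)%R| <= `|(h.2%:Z - Z%:Z)%R|),
  (inord (u h) : 'I_t.+1, inord (w h) : 'I_(3 * Z).+1)).
have Hc : #|[pred h : 'I_(2 * Z) * 'I_(2 * Z) | height (h.1%:Z - Z%:Z)%R (h.2%:Z - Z%:Z)%R <= t]| <=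
    #|{: (bool * bool * bool) * ('I_t.+1 * 'I_(3 * Z).+1)}|.
  apply: (leq_card_inj_on (f := code)) => // h h'; rewrite !inE -!uE => ht h't [e1 e2 e3].
  move=> /(congr1 val) /=; rewrite !inordK ?ltnS // => eu.
  move=> /(congr1 val) /=; rewrite !inordK // => ew.
  move: ew; rewrite /w -eu => ew.
  have ev : v h = v h'.
    have := congr1 (modn^~ (u h).+1) ew.
    by rewrite !modnMDl !modn_small ?ltnS // eu.
  have eg : g h = g h' by apply/eqP; move/eqP: ew; rewrite ev eqn_add2r eqn_mul2r.
  have en : n h = n h' by rewrite !nE eu eg.
  have em : m h = m h' by rewrite !mE ev eg.
  case: h h' {ht h't eu ew ev eg code w wlt gn un nZ vu mE nE uE gE} e1 e2 e3 en em => [i j] [i' j'] /=.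
  rewrite /n /m /= => e1 e2 e3 en em.
  by congr pair; apply: val_inj => /=; lia.
apply: leq_trans Hc _; rewrite !card_prod !card_bool !card_ord; nia.
Qed.

Lemma card_height_eq0 (Z : nat) :
  #|[pred h : 'I_(2 * Z) * 'I_(2 * Z) | height (h.1%:Z - Z%:Z)%R (h.2%:Z - Z%:Z)%R <= 0]| <= 1.
Proof.
apply: (leq_card_code (f := fun=> 0)) => // [[i j] [i' j']]; rewrite !inE !leqn0 /=.
move=> /eqP/height_eq0[ei ej] /eqP/height_eq0[ei' ej'] _.
by congr pair; apply: val_inj => /=; lia.
Qed.

(** For [h] of height [H > 0] there are at most [64 * Z * H] partners of no larger height, each
    contributing at most [D / H]; the heights cancel. At height [0] there is a single partner and
    the bound [D * Z] suffices. *)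
Lemma sum_by_height_half (Z D : nat) (c : 'I_(2 * Z) * 'I_(2 * Z) -> 'I_(2 * Z) * 'I_(2 * Z) -> nat) :
  let ht (h : 'I_(2 * Z) * 'I_(2 * Z)) := height (h.1%:Z - Z%:Z)%R (h.2%:Z - Z%:Z)%R in
  0 < Z ->
  (forall h h', c h h' * ht h <= D) -> (forall h h', c h h' <= D * Z) ->
  \sum_h \sum_(h' | ht h' <= ht h) c h h' <= 256 * D * Z ^ 3.
Proof.
move=> ht Z0 cD cM.
have -> : 256 * D * Z ^ 3 = \sum_(h : 'I_(2 * Z) * 'I_(2 * Z)) 64 * D * Z.
  rewrite sum_nat_const card_prod !card_ord; ring.
apply: leq_sum => h _; have [h0|h0] := posnP (ht h).
  rewrite h0; apply: (@leq_trans (\sum_(h' | ht h' <= 0) D * Z)); first exact: leq_sum.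
  rewrite sum_nat_const; apply: leq_trans (leq_mul (card_height_eq0 Z) (leqnn _)) _; nia.
apply: (@leq_trans (\sum_(h' | ht h' <= ht h) D %/ ht h)).
  by apply: leq_sum => h' _; rewrite leq_divRL.
rewrite sum_nat_const; apply: leq_trans (leq_mul (card_height_le Z0 h0) (leqnn _)) _.
by have := leq_trunc_div D (ht h); rewrite -/(ht _); nia.
Qed.

Lemma sum_by_height (Z D : nat) (c : 'I_(2 * Z) * 'I_(2 * Z) -> 'I_(2 * Z) * 'I_(2 * Z) -> nat) :
  let ht (h : 'I_(2 * Z) * 'I_(2 * Z)) := height (h.1%:Z - Z%:Z)%R (h.2%:Z - Z%:Z)%R in
  0 < Z ->
  (forall h h', c h h' * ht h <= D) -> (forall h h', c h h' * ht h' <= D) ->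
  (forall h h', c h h' <= D * Z) ->
  \sum_h \sum_h' c h h' <= 512 * D * Z ^ 3.
Proof.
move=> ht Z0 cD cD' cM.
apply: (@leq_trans (\sum_h \sum_(h' | ht h' <= ht h) c h h' + \sum_h' \sum_(h | ht h <= ht h') c h h')).
  rewrite [X in _ <= _ + X](exchange_big_dep predT) //= -big_split; apply: leq_sum => h _.
  rewrite [leqLHS](bigID (fun h' => ht h' <= ht h)) /= leq_add2l.
  rewrite big_mkcond [leqRHS]big_mkcond; apply: leq_sum => h' _.
  by case: (leqP (ht h') (ht h)) => [_|/ltnW ->].
have := @sum_by_height_half Z D c Z0 cD cM.
have := @sum_by_height_half Z D (fun h' h => c h h') Z0 (fun h' h => cD' h h') (fun h' h => cM h h').
rewrite -/ht => H1 H2; apply: leq_trans (leq_add H2 H1) _; nia.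
Qed.

(** * The energy of a quadratic form *)

(** [e * quad e z] is the triangular number of [2 * e * z]. *)
Definition quad (e z : nat) : nat := z * (2 * e * z + 1).

Section Energy.
Variables (b0 b1 b2 b3 b4 e Z : nat).
Hypotheses (b0_gt0 : 0 < b0) (b1_gt0 : 0 < b1) (b2_gt0 : 0 < b2) (b3_gt0 : 0 < b3) (b4_gt0 : 0 < b4).
Hypotheses (e_gt0 : 0 < e) (Z_gt0 : 0 < Z).

Local Notation pt := ('I_Z * 'I_Z)%type.
Local Notation df := ('I_(2 * Z) * 'I_(2 * Z))%type.

(** Four variables run below [Z], the fifth only below [e]: it is there to exploit a congruence
    modulo [2 * e]. *)
Definition quad_form (a : (pt * pt) * 'I_e) : nat :=
  b0 * quad e a.1.1.1 + b1 * quad e a.1.1.2 + b2 * quad e a.1.2.1 + b3 * quad e a.1.2.2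
  + b4 * quad e a.2.

(** Differences of elements of ['I_Z] are stored with offset [Z]. *)
Let dz (i : 'I_(2 * Z)) : int := (i%:Z - Z%:Z)%R.

Lemma shift_subproof (z z' : 'I_Z) : z' + (Z - z) < 2 * Z.
Proof. by have := ltn_ord z; have := ltn_ord z'; lia. Qed.

Definition shift (z z' : 'I_Z) : 'I_(2 * Z) := Ordinal (shift_subproof z z').

Lemma shiftE (z z' : 'I_Z) : dz (shift z z') = (z'%:Z - z%:Z)%R.
Proof. by rewrite /dz /=; have := ltn_ord z; lia. Qed.

(** For a fixed difference [d] the increment of [b * quad e] is affine in [z], so coincidences with
    prescribed differences satisfy linear equations. *)
Definition quad_diff (b : nat) (d : int) (z : nat) : int :=
  (b%:Z * (d * (2 * e%:Z * (2 * z%:Z + d) + 1)))%R.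

Lemma quad_diffE (b : nat) (z z' : nat) :
  quad_diff b (z'%:Z - z%:Z)%R z = ((b * quad e z')%N%:Z - (b * quad e z)%N%:Z)%R.
Proof. by rewrite /quad_diff /quad; ring. Qed.

Let coinc (y : (df * df) * (('I_e * 'I_e) * (pt * pt))) : bool :=
  (quad_diff b0 (dz y.1.1.1) y.2.2.1.1 + quad_diff b1 (dz y.1.1.2) y.2.2.1.2
   + quad_diff b2 (dz y.1.2.1) y.2.2.2.1 + quad_diff b3 (dz y.1.2.2) y.2.2.2.2
   + quad_diff b4 (y.2.1.2%:Z - y.2.1.1%:Z) y.2.1.1 == 0)%R.

Let cong (h h' : df) (w : 'I_e * 'I_e) : bool :=
  (2 * e%:Z %| b0%:Z * dz h.1 + b1%:Z * dz h.2 + b2%:Z * dz h'.1 + b3%:Z * dz h'.2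
    + b4%:Z * (w.2%:Z - w.1%:Z))%Z%R.

(** Modulo [2 * e] the value [quad e z] is just [z]. *)
Lemma coinc_cong h h' w x : coinc ((h, h'), (w, x)) -> cong h h' w.
Proof.
rewrite /coinc /cong /quad_diff /= => /eqP E.
apply/dvdzP; exists (- (b0%:Z * dz h.1 * (2 * x.1.1%:Z + dz h.1)
  + b1%:Z * dz h.2 * (2 * x.1.2%:Z + dz h.2)
  + b2%:Z * dz h'.1 * (2 * x.2.1%:Z + dz h'.1)
  + b3%:Z * dz h'.2 * (2 * x.2.2%:Z + dz h'.2)
  + b4%:Z * (w.2%:Z - w.1%:Z) * (w.1%:Z + w.2%:Z)))%R.
by rewrite -[LHS]subr0 -[X in (_ - X)%R]E; ring.
Qed.

(* This count is where the energy gains a factor [e] over the trivial bound. *)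
Lemma card_cong h h' : \sum_w cong h h' w <= e * (b4 + 1).
Proof.
rewrite -(pair_bigA _ (fun w1 w2 => (cong h h' (w1, w2) : nat))) /=.
rewrite -[X in _ <= X * _]card_ord -sum_nat_const; apply: leq_sum => w1 _.
rewrite sum_bool_card.
have : (b4 * e) %/ (2 * e) + 1 <= b4 + 1 by rewrite leq_add2r divnMr // leq_div.
apply: leq_trans; apply: card_linear_congr => //; first by rewrite muln_gt0.
move=> x y; rewrite /cong /= => /dvdzP[k kE] /dvdzP[k' k'E].
have : (b4%:Z * x%:Z - b4%:Z * y%:Z = (k - k') * (2 * e%:Z))%R by rewrite mulrBl -kE -k'E; ring.
move=> E.
have : ((b4 * x)%N%:Z == (b4 * y)%N%:Z %[mod (2 * e)%N%:Z])%Z.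
  by rewrite eqz_mod_dvd !PoszM; apply/dvdzP; exists (k - k')%R.
by rewrite !modz_nat => /eqP[->].
Qed.

Let cnt (h h' : df) : nat := \sum_w coinc ((h, h'), w).

Lemma dz_le i : `|dz i| <= Z.
Proof. by rewrite /dz; have := ltn_ord i; lia. Qed.

(** Only the [w] allowed by [cong] contribute, so a bound valid for each [w] is multiplied by
    [e * (b4 + 1)] instead of [e ^ 2]. *)
Lemma cnt_leP (D s : nat) h h' :
  (forall w, (\sum_x coinc ((h, h'), (w, x))) * s <= D) -> cnt h h' * s <= e * (b4 + 1) * D.
Proof.
move=> ND; rewrite /cnt -(pair_bigA _ (fun w x => (coinc ((h, h'), (w, x)) : nat))) /=.
apply: (@leq_trans (\sum_w cong h h' w * D)); last first.
  by rewrite -big_distrl leq_mul2r card_cong orbT.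
rewrite big_distrl; apply: leq_sum => w _ /=.
have [Cw|/negP Cw] := boolP (cong h h' w); first by rewrite mul1n.
by rewrite big1 // => x _; case: (boolP (coinc _)) => // /coinc_cong.
Qed.

Lemma cnt_le h h' : cnt h h' <= e * (b4 + 1) * Z ^ 4.
Proof.
rewrite -[cnt _ _]muln1; apply: cnt_leP => w; rewrite muln1.
apply: (@leq_trans (\sum_(x : pt * pt) 1)); first by apply: leq_sum => x _; apply: leq_b1.
by rewrite sum1_card !card_prod !card_ord; lia.
Qed.

(** With [w] and the second pair of points frozen, subtracting two solutions leaves, up to the
    factor [4 * e], a homogeneous linear equation in the first pair. *)
Lemma cnt_height_l h h' :
  cnt h h' * height (dz h.1) (dz h.2) <= e * (b4 + 1) * ((b0 + b1 + 1) * Z ^ 3).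
Proof.
apply: cnt_leP => w; rewrite -(pair_bigA _ (fun x y => (coinc ((h, h'), (w, (x, y))) : nat))) /=.
rewrite exchange_big big_distrl /=.
have -> : (b0 + b1 + 1) * Z ^ 3 = \sum_(y : pt) (b0 + b1 + 1) * Z.
  by rewrite sum_nat_const card_prod card_ord; ring.
apply: leq_sum => y _; rewrite sum_bool_card; apply: card_linear_pair; rewrite ?dz_le //.
move=> x x'; rewrite /coinc /quad_diff /= => /eqP E /eqP E'.
apply: (@mulfI _ (4 * e%:Z)%R); first by lia.
rewrite mulr0 -[RHS](subrr 0%R) -{1}E -E'; ring.
Qed.

Lemma cnt_height_r h h' :
  cnt h h' * height (dz h'.1) (dz h'.2) <= e * (b4 + 1) * ((b2 + b3 + 1) * Z ^ 3).
Proof.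
apply: cnt_leP => w; rewrite -(pair_bigA _ (fun x y => (coinc ((h, h'), (w, (x, y))) : nat))) /=.
rewrite big_distrl /=.
have -> : (b2 + b3 + 1) * Z ^ 3 = \sum_(y : pt) (b2 + b3 + 1) * Z.
  by rewrite sum_nat_const card_prod card_ord; ring.
apply: leq_sum => y _; rewrite sum_bool_card; apply: card_linear_pair; rewrite ?dz_le //.
move=> x x'; rewrite /coinc /quad_diff /= => /eqP E /eqP E'.
apply: (@mulfI _ (4 * e%:Z)%R); first by lia.
rewrite mulr0 -[RHS](subrr 0%R) -{1}E -E'; ring.
Qed.

Lemma quad_form_energy :
  \sum_(p : ((pt * pt) * 'I_e) * ((pt * pt) * 'I_e)) (quad_form p.1 == quad_form p.2)
  <= 512 * (e * (b4 + 1) * ((b0 + b1 + b2 + b3 + 1) * Z ^ 3)) * Z ^ 3.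
Proof.
(* Change of variables: the four differences, both values of the fifth variable, and the first
   point. The sum is then organised by the heights of the differences. *)
pose F (p : ((pt * pt) * 'I_e) * ((pt * pt) * 'I_e)) :
    (df * df) * (('I_e * 'I_e) * (pt * pt)) :=
  (((shift p.1.1.1.1 p.2.1.1.1, shift p.1.1.1.2 p.2.1.1.2),
    (shift p.1.1.2.1 p.2.1.2.1, shift p.1.1.2.2 p.2.1.2.2)),
   ((p.1.2, p.2.2), p.1.1)).
have shift_inj z z' z'' : shift z z' = shift z z'' -> z' = z''.
  by move=> /(congr1 val) /= E; apply: val_inj; move: E => /=; lia.
have Finj : injective F.
  move=> [[[[x0 x1] [x2 x3]] x4] [[[x0' x1'] [x2' x3']] x4']].
  move=> [[[[y0 y1] [y2 y3]] y4] [[[y0' y1'] [y2' y3']] y4']].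
  rewrite /F /= => E.
  have := congr1 (fun y => y.2.2.1.1) E => /= E0; have := congr1 (fun y => y.2.2.1.2) E => /= E1.
  have := congr1 (fun y => y.2.2.2.1) E => /= E2; have := congr1 (fun y => y.2.2.2.2) E => /= E3.
  have := congr1 (fun y => y.2.1.1) E => /= E4; have := congr1 (fun y => y.2.1.2) E => /= E4'.
  subst y0 y1 y2 y3 y4 y4'.
  have := congr1 (fun y => y.1.1.1) E => /= /shift_inj ->.
  have := congr1 (fun y => y.1.1.2) E => /= /shift_inj ->.
  have := congr1 (fun y => y.1.2.1) E => /= /shift_inj ->.
  by have := congr1 (fun y => y.1.2.2) E => /= /shift_inj ->.
have -> : \sum_(p : ((pt * pt) * 'I_e) * ((pt * pt) * 'I_e)) (quad_form p.1 == quad_form p.2)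
    = \sum_p coinc (F p).
  apply: eq_bigr => p _; congr (nat_of_bool _).
  rewrite /coinc /F /= !shiftE !quad_diffE /quad_form.
  by apply/eqP/eqP; lia.
apply: leq_trans (leq_sum_inj (fun y => coinc y : nat) Finj) _.
rewrite -(pair_bigA _ (fun hh x => (coinc (hh, x) : nat))) /=.
rewrite -(pair_bigA _ (fun h h' => \sum_x (coinc ((h, h'), x) : nat))) /=.
apply: sum_by_height => // [h h'|h h'|h h'].
- apply: leq_trans (cnt_height_l h h') _; rewrite !leq_mul2l leq_mul2r.
  by apply/orP; right; apply/orP; right; lia.
- apply: leq_trans (cnt_height_r h h') _; rewrite !leq_mul2l leq_mul2r.
  by apply/orP; right; apply/orP; right; lia.
- apply: leq_trans (cnt_le h h') _; nia.
Qed.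

End Energy.

(** * Representations *)

Definition rep (b : nat -> nat) (J K n : nat) : Prop :=
  exists x : nat -> nat, n = \sum_(J <= i < K) b i * triangular (x i).

Lemma triangular2 (x : nat) : 2 * triangular x = x * (x + 1).
Proof. by rewrite /triangular mulnC divnK // dvdn2 oddM addn1 /=; case: odd. Qed.

Lemma triangular_quad (e z : nat) : triangular (2 * e * z) = e * quad e z.
Proof. by apply/eqP; rewrite -(eqn_pmul2l (isT : 0 < 2)) triangular2 /quad; apply/eqP; ring. Qed.

Lemma triangular_quad_pred (e z : nat) :
  0 < e -> 0 < z -> triangular (2 * e * z - 1) = e * (z * (2 * e * z - 1)).
Proof.
move=> e0 z0; apply/eqP; rewrite -(eqn_pmul2l (isT : 0 < 2)) triangular2 subnK; last by nia.
by apply/eqP; ring.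
Qed.

Lemma rep_nil b J K : rep b J K 0.
Proof. by exists (fun=> 0); rewrite big1 // => i _; rewrite muln0. Qed.

Lemma rep_cat b J K L m n : J <= K <= L -> rep b J K m -> rep b K L n -> rep b J L (m + n).
Proof.
move=> /andP[JK KL] [x ->] [y ->]; exists (fun i => if i < K then x i else y i).
rewrite (big_cat_nat JK KL) /=; congr addn; rewrite big_nat_cond [RHS]big_nat_cond.
  by apply: eq_bigr => i /andP[/andP[_ ->]].
by apply: eq_bigr => i /andP[/andP[]]; rewrite leqNgt => /negbTE ->.
Qed.

Lemma rep_widen b J J' K K' n : J' <= J <= K -> K <= K' -> rep b J K n -> rep b J' K' n.
Proof.
move=> /andP[JJ JK] KK Hn; rewrite -[n]addn0 -[n]add0n -addnA.
apply: (@rep_cat _ _ J); rewrite ?JJ ?(leq_trans JK) //; first exact: rep_nil.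
by apply: (@rep_cat _ _ K); rewrite ?JK //; exact: rep_nil.
Qed.

Lemma rep_single b i x : rep b i i.+1 (b i * triangular x).
Proof. by exists (fun=> x); rewrite big_nat1. Qed.

Lemma rep_snoc b J K m x : J <= K -> rep b J K m -> rep b J K.+1 (m + b K * triangular x).
Proof. by move=> JK Hm; apply: (@rep_cat _ _ K) (rep_single _ _ _) => //; rewrite JK /=. Qed.

Lemma rep_offset b J K n : rep (fun i => b (J + i)) 0 K n <-> rep b J (J + K) n.
Proof.
have E F : \sum_(J <= i < J + K) F i = \sum_(0 <= i < K) F (i + J).
  by rewrite -{1}[J]add0n big_addn addKn.
split=> -[x ->].
  by exists (fun i => x (i - J)); rewrite E; apply: eq_bigr => i _; rewrite addnK addnC.
by exists (fun i => x (J + i)); rewrite E; apply: eq_bigr => i _; rewrite addnC.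
Qed.

(** * Positive density of five terms *)

Definition cardlt (P : nat -> Prop) (X : nat) : nat := #|[pred v : 'I_X | `[<P v>]]|.

Lemma between_values (f : nat -> nat) (m : nat) :
  f 0 <= m -> (forall z, z <= f z) -> exists z, f z <= m < f z.+1.
Proof.
move=> f0 fz; have bd i : f i <= m -> i <= m by apply: leq_trans.
case: (ex_maxnP (ex_intro (fun z => f z <= m) 0 f0) bd) => z Hz zmax.
by exists z; rewrite Hz ltnNge; apply/negP => /zmax; rewrite ltnn.
Qed.

(** [quad_form] has [e * Z ^ 4] arguments and energy at most [D * e * Z ^ 6], hence at least
    [e * Z ^ 2 / D] values, all below [3 * s * e * Z ^ 2]. The factor [e] cancels, so [C] depends on
    the coefficients only. *)
Lemma rep_density (b : nat -> nat) (J : nat) : (forall i, 0 < b i) ->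
  exists2 C, 0 < C & forall e, 0 < e -> exists X0, forall X, X0 <= X ->
    X <= C * cardlt (fun v => rep b J (J + 5) (e * v)) X.
Proof.
move=> b_gt0.
pose b0 := b J; pose b1 := b J.+1; pose b2 := b J.+2; pose b3 := b J.+3; pose b4 := b J.+4.
have [p0 p1 p2 p3 p4] : [/\ 0 < b0, 0 < b1, 0 < b2, 0 < b3 & 0 < b4] by split; apply: b_gt0.
pose s := b0 + b1 + b2 + b3 + b4.
pose D := 512 * (b4 + 1) * (b0 + b1 + b2 + b3 + 1).
have s_gt0 : 0 < s by rewrite /s; lia.
exists (12 * s * D); first by rewrite /D; nia.
move=> e e_gt0; exists (3 * s * e * (e + 1) ^ 2) => X HX.
have [Z /andP[Zle Zlt]] : exists Z, 3 * s * e * Z ^ 2 <= X < 3 * s * e * Z.+1 ^ 2.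
  apply: (between_values (f := fun z => 3 * s * e * z ^ 2)) => [|z]; first by rewrite muln0.
  by apply: (@leq_trans (z ^ 2)); [rewrite -mulnn; nia|rewrite leq_pmull // !muln_gt0 s_gt0 e_gt0].
(* [X0] is chosen for this: the fifth variable, being below [e], then obeys the same size bound as
   the others. *)
have eZ : e <= Z.
  rewrite -ltnS -(ltn_sqr e) -(ltn_pmul2l (_ : 0 < 3 * s * e)) ?muln_gt0 ?s_gt0 //.
  by apply: leq_ltn_trans Zlt; apply: leq_trans HX; rewrite leq_mul2l; apply/orP; right; lia.
have Z_gt0 : 0 < Z by lia.
pose A := (('I_Z * 'I_Z) * ('I_Z * 'I_Z) * 'I_e)%type.
have fX (a : A) : quad_form b0 b1 b2 b3 b4 a < X.
  have qz c z : 0 < c -> z < Z -> c * quad e z < c * (3 * e * Z ^ 2).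
    move=> c_gt0 zZ; rewrite ltn_pmul2l // /quad.
    apply: (@leq_ltn_trans (z * (3 * e * Z))); first by rewrite leq_mul2l; nia.
    by rewrite [ltnRHS](_ : _ = Z * (3 * e * Z)) ?ltn_pmul2r ?muln_gt0 ?e_gt0 //; ring.
  apply: leq_trans Zle; rewrite [leqRHS](_ : _ = s * (3 * e * Z ^ 2)); last by ring.
  have h0 := qz _ _ p0 (ltn_ord a.1.1.1); have h1 := qz _ _ p1 (ltn_ord a.1.1.2).
  have h2 := qz _ _ p2 (ltn_ord a.1.2.1); have h3 := qz _ _ p3 (ltn_ord a.1.2.2).
  have h4 := qz _ _ p4 (leq_trans (ltn_ord a.2) eZ).
  by rewrite /quad_form /s !mulnDl; lia.
pose f (a : A) : 'I_X := Ordinal (fX a).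
have HV : #|[set f x | x in {: A}]| <= cardlt (fun v => rep b J (J + 5) (e * v)) X.
  apply/subset_leq_card/fintype.subsetP => v /imsetP[a _ ->]; rewrite inE /=.
  have E c z : e * (c * quad e z) = c * triangular (2 * e * z) by rewrite triangular_quad mulnCA.
  rewrite /quad_form !mulnDr !E !addnS addn0.
  by do 4 (apply: rep_snoc; first lia); rewrite /b0; apply: rep_single.
have HE := image_energy f; rewrite !card_prod !card_ord in HE.
have HEn : \sum_(p : A * A) (f p.1 == f p.2) <= D * e * Z ^ 6.
  have := quad_form_energy p0 p1 p2 p3 p4 e_gt0 Z_gt0; rewrite /D => H.
  apply: leq_trans (leq_trans H _); last by apply: eq_leq; ring.
  by apply: leq_sum => p _; rewrite -val_eqE.
set V := #|_| in HV HE.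
have H1 : e * Z ^ 2 <= D * V.
  rewrite -(leq_pmul2l (_ : 0 < e * Z ^ 6)); last by rewrite muln_gt0 e_gt0 expn_gt0 Z_gt0.
  have H := leq_trans HE (leq_mul (leqnn V) HEn).
  by rewrite (_ : _ * (D * V) = V * (D * e * Z ^ 6)) ?(leq_trans _ H) //; [apply: eq_leq|]; ring.
apply: leq_trans (ltnW Zlt) _; apply: (@leq_trans (3 * s * e * (4 * Z ^ 2))).
  by rewrite leq_mul2l; apply/orP; right; rewrite -[4]/(2 ^ 2) -expnMn leq_sqr; lia.
rewrite [leqLHS](_ : _ = 12 * s * (e * Z ^ 2)); last by ring.
rewrite -[leqRHS]mulnA leq_mul2l; apply/orP; right; apply: leq_trans H1 _.
by rewrite leq_mul2l HV orbT.
Qed.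

(** * Near-invariance under shifts *)

Section NearInvariance.
Variables (G : pred nat) (X : nat).

Definition escape (s : nat) : nat := #|[pred a : 'I_X | G a && ~~ ((a + s < X) && G (a + s))]|.

(** A point escaping under [s + t] escapes under [s], or is carried by [s] to a point escaping under
    [t]. *)
Lemma escapeD s t : escape (s + t) <= escape s + escape t.
Proof.
pose P s := [pred a : 'I_X | G a && ~~ ((a + s < X) && G (a + s))].
pose Q := [pred a : 'I_X | P (s + t) a && ~~ P s a].
have H1 : #|P (s + t)| <= #|P s| + #|Q|.
  rewrite -(cardID (P s) (P (s + t))); apply: leq_add; apply/subset_leq_card/fintype.subsetP => a.
    by case/andP.
  by rewrite !inE /= andbC.
apply: leq_trans H1 _; rewrite leq_add2l.
apply: (leq_card_inj_on (f := fun a : 'I_X => insubd a (a + s))) => [a a'|a].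
  move=> /andP[/andP[Ga _]]; rewrite /= Ga /= negbK => /andP[aX _] /andP[/andP[Ga' _]].
  rewrite /= Ga' /= negbK => /andP[a'X _] /(congr1 val); rewrite !val_insubd aX a'X => /addIn.
  exact: val_inj.
move=> /andP[/andP[Ga Hst]]; rewrite /= Ga /= negbK => /andP[aX Gas].
by rewrite val_insubd aX Gas /= -addnA.
Qed.

(** Go back by [s], then forward by [t]. No more points fail backwards than forwards, because the
    shift by [s] embeds the points surviving forwards into those surviving backwards. *)
Lemma escapeB s t : s <= t -> escape (t - s) <= escape s + escape t.
Proof.
move=> st.
pose P s := [pred a : 'I_X | G a && ~~ ((a + s < X) && G (a + s))].
pose Ok s := [pred a : 'I_X | G a && ((a + s < X) && G (a + s))].
pose Bk s := [pred a : 'I_X | G a && ~~ ((s <= a) && G (a - s))].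
pose Okb s := [pred a : 'I_X | G a && ((s <= a) && G (a - s))].
have PG : #|Ok s| + #|P s| = #|[pred a : 'I_X | G a]|.
  rewrite -(cardID (Ok s) [pred a : 'I_X | G a]); congr addn; apply: eq_card => a; rewrite !inE /=.
    by case: (G a); rewrite //= andbT.
  by case: (G a); rewrite //= ?andbT ?andbF.
have BG : #|Okb s| + #|Bk s| = #|[pred a : 'I_X | G a]|.
  rewrite -(cardID (Okb s) [pred a : 'I_X | G a]); congr addn; apply: eq_card => a; rewrite !inE /=.
    by case: (G a); rewrite //= andbT.
  by case: (G a); rewrite //= ?andbT ?andbF.
have OO : #|Ok s| <= #|Okb s|.
  apply: (leq_card_inj_on (f := fun a : 'I_X => insubd a (a + s))) => [a a'|a].
    move=> /and3P[_ aX _] /and3P[_ a'X _] /(congr1 val).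
    by rewrite !val_insubd aX a'X => /addIn/val_inj.
  by move=> /and3P[Ga aX Gas]; rewrite /= val_insubd aX Gas leq_addl addnK.
have BP : #|Bk s| <= #|P s| by lia.
pose Q := [pred a : 'I_X | P (t - s) a && ~~ Bk s a].
have H1 : #|P (t - s)| <= #|Bk s| + #|Q|.
  rewrite -(cardID (Bk s) (P (t - s))); apply: leq_add; apply/subset_leq_card/fintype.subsetP => a.
    by case/andP.
  by rewrite !inE /= andbC.
apply: leq_trans H1 (leq_add BP _).
have aX (a : 'I_X) : a - s < X by apply: leq_ltn_trans (ltn_ord a); apply: leq_subr.
apply: (leq_card_inj_on (f := fun a : 'I_X => Ordinal (aX a))) => [a a'|a].
  move=> /andP[/andP[Ga _]]; rewrite /= Ga /= negbK => /andP[sa _] /andP[/andP[Ga' _]].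
  rewrite /= Ga' /= negbK => /andP[sa' _] /(congr1 val) /= E; apply: val_inj => /=; lia.
move=> /andP[/andP[Ga Hst]]; rewrite /= Ga /= negbK => /andP[sa Gas].
by rewrite Gas /=; have -> : a - s + t = a + (t - s) by lia.
Qed.

(** An escaping translate either passes [X], which happens for at most [s] points, or lies in [G']
    outside [G]. *)
Lemma escape_le (G' : pred nat) s :
  (forall v, G v -> G' v) -> (forall v, G v -> G' (v + s)) ->
  escape s <= (#|[pred v : 'I_X | G' v]| - #|[pred v : 'I_X | G v]|) + s.
Proof.
move=> GG' Gs.
pose D := [pred v : 'I_X | G' v && ~~ G v].
have HD : #|[pred v : 'I_X | G' v]| = #|[pred v : 'I_X | G v]| + #|D|.
  rewrite -(cardID [pred v : 'I_X | G v] [pred v : 'I_X | G' v]); congr addn; apply: eq_card => a.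
    by rewrite !inE /=; case: (boolP (G a)) => [/GG' ->|]; rewrite ?andbF.
  by rewrite !inE /= andbC.
rewrite HD addKn addnC.
pose E := [pred a : 'I_X | X <= a + s].
pose P := [pred a : 'I_X | G a && ~~ ((a + s < X) && G (a + s))].
rewrite /escape -/P -(cardID E P); apply: leq_add.
  apply: (leq_card_code (f := fun a : 'I_X => a + s - X)) => [a a'|a].
    move=> /andP[_ aX] /andP[_ a'X]; have {}aX : X <= a + s := aX; have {}a'X : X <= a' + s := a'X.
    by move=> E'; apply: val_inj => /=; lia.
  by move=> /andP[_ aX]; have {}aX : X <= a + s := aX; have := ltn_ord a; lia.
apply: (leq_card_inj_on (f := fun a : 'I_X => insubd a (a + s))) => [a a'|a].
  move=> /andP[aX _] /andP[a'X _] /(congr1 val).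
  have {}aX : ~~ (X <= a + s) := aX; have {}a'X : ~~ (X <= a' + s) := a'X.
  by rewrite -ltnNge in aX; rewrite -ltnNge in a'X; rewrite !val_insubd aX a'X => /addIn/val_inj.
move=> /andP[aX /andP[Ga nGas]]; have {}aX : ~~ (X <= a + s) := aX; rewrite -ltnNge in aX.
by move: nGas; rewrite aX /= => nGas; rewrite val_insubd aX nGas Gs.
Qed.

End NearInvariance.

(* If [G'] is barely larger than [G] below [X], then [G] is nearly invariant under the given shifts, *)
(* hence under all shifts beyond [2 * e + 1], because [z * (2 * e * z + 1) - z * (2 * e * z - 1) = 2 * z] *)
(* and [2 * e + 1] is odd; averaging over the shifts gives the window. *)
Lemma full_window (G G' : pred nat) (e X W : nat) :
  0 < e -> 2 * e + 1 <= W ->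
  (forall v, G v -> G' v) ->
  (forall v z, G v -> G' (v + z * (2 * e * z + 1))) ->
  (forall v z, G v -> G' (v + z * (2 * e * z - 1))) ->
  0 < #|[pred v : 'I_X | G v]| ->
  exists2 w, w <= X + 2 * e &
    #|[pred s : 'I_W | ~~ G (w + s)]| * #|[pred v : 'I_X | G v]|
    <= W * (3 * (#|[pred v : 'I_X | G' v]| - #|[pred v : 'I_X | G v]|) + 3 * (W * (2 * e * W + 1))).
Proof.
move=> e0 eW GG' Gp Gm G0.
set g := #|[pred v : 'I_X | G v]|; set d := #|[pred v : 'I_X | G' v]| - g.
set Q := W * (2 * e * W + 1).
have qQ z : z <= W -> z * (2 * e * z + 1) <= Q.
  by move=> zW; apply: leq_mul => //; rewrite leq_add2r leq_mul2l zW orbT.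
have bp z : z <= W -> escape G X (z * (2 * e * z + 1)) <= d + Q.
  move=> zW; apply: leq_trans (escape_le X GG' (fun v => Gp v z)) _.
  by rewrite -/g -/d leq_add2l qQ.
have bm z : z <= W -> escape G X (z * (2 * e * z - 1)) <= d + Q.
  move=> zW; apply: leq_trans (escape_le X GG' (fun v => Gm v z)) _.
  rewrite -/g -/d leq_add2l; apply: leq_trans (qQ z zW).
  by rewrite leq_mul2l; apply/orP; right; lia.
have b2 z : z <= W -> escape G X (2 * z) <= 2 * (d + Q).
  move=> zW; have -> : 2 * z = z * (2 * e * z + 1) - z * (2 * e * z - 1).
    have [->|z0] := posnP z; first by rewrite !muln0.
    rewrite -mulnBr mulnC; congr muln; have : 0 < 2 * e * z by rewrite !muln_gt0 e0 z0.
    lia.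
  rewrite [leqRHS]mul2n -addnn; apply: leq_trans (escapeB _ _ _) (leq_add (bm z zW) (bp z zW)).
  by rewrite leq_mul2l; apply/orP; right; lia.
have b1 : escape G X (2 * e + 1) <= d + Q.
  by have := bp 1; rewrite muln1 mul1n; apply; lia.
have bs s : s < W -> escape G X (s + (2 * e + 1)) <= 3 * (d + Q).
  move=> sW; case: (boolP (odd s)) => so.
    have -> : s + (2 * e + 1) = 2 * (s./2 + e + 1) by have := odd_double_half s; rewrite so; lia.
    apply: leq_trans (b2 (s./2 + e + 1) _) _; last by lia.
    by have := odd_double_half s; rewrite so; lia.
  have {1}-> : s = 2 * s./2 by have := odd_double_half s; rewrite (negbTE so); lia.
  apply: leq_trans (escapeD _ _ _ _) _; apply: (leq_trans (leq_add (b2 s./2 _) b1)); last by lia.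
  by have := odd_double_half s; lia.
pose bad (a : 'I_X) := #|[pred s : 'I_W | ~~ G (a + (2 * e + 1) + s)]|.
have Hsum : \sum_(a : 'I_X | G a) bad a <= W * (3 * d + 3 * Q).
  have -> : \sum_(a : 'I_X | G a) bad a =
     \sum_(s < W) #|[pred a : 'I_X | G a && ~~ G (a + (2 * e + 1) + s)]|.
    transitivity (\sum_(a : 'I_X | G a) \sum_(s < W) ~~ G (a + (2 * e + 1) + s)).
      by apply: eq_bigr => a _; rewrite sum_bool_card.
    rewrite exchange_big /=; apply: eq_bigr => s _.
    transitivity (\sum_(a : 'I_X) (G a && ~~ G (a + (2 * e + 1) + s))); last by rewrite sum_bool_card.
    by rewrite big_mkcond; apply: eq_bigr => a _; case: (G a).
  rewrite -mulnDr -[X in _ <= X * _]card_ord -sum_nat_const; apply: leq_sum => s _.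
  apply: leq_trans (bs s (ltn_ord s)); apply/subset_leq_card/fintype.subsetP => a.
  rewrite !inE => /andP[-> nG]; rewrite negb_and orbC /=; apply/orP; left.
  by rewrite (addnC s) addnA.
have [a Ga Ha] : exists2 a : 'I_X, G a & bad a * g <= W * (3 * d + 3 * Q).
  have /card_gt0P[a0 Ga0] := G0.
  case: (arg_minnP (fun a => bad a) Ga0) => a Ga amin; exists a => //.
  apply: leq_trans Hsum; rewrite mulnC /g -sum_nat_const; apply: leq_sum => a' Ga'.
  exact: amin.
exists (a + (2 * e + 1)) => //.
by have := ltn_ord a; lia.
Qed.

(** * Full windows and large multiples *)

Lemma small_increment (N : nat -> nat) (k X : nat) :
  0 < k -> {homo N : i j / i <= j} -> N k <= X -> exists2 i, i < k & k * (N i.+1 - N i) <= X.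
Proof.
move=> k0 Nmono NkX; apply: contrapT => H.
have {}H i : i < k -> X < k * (N i.+1 - N i).
  by move=> ik; rewrite ltnNge; apply/negP => Hi; apply: H; exists i.
have : forall j, j <= k -> j * X.+1 <= k * N j.
  elim=> [|j IH] jk //; have := H j jk; have := IH (ltnW jk).
  have : k * N j <= k * N j.+1 by rewrite leq_mul2l Nmono ?orbT.
  by rewrite mulnBr mulSn; lia.
by move=> /(_ k (leqnn k)); rewrite leq_pmul2l //; lia.
Qed.

(** Terms [0] to [4] fill gaps, terms [5] to [9] provide an initial density, and the next [k] terms
    are added until one of them brings little gain. *)
Lemma rep_window (b : nat -> nat) : (forall i, 0 < b i) ->
  exists K M C, [/\ 0 < M, 0 < C &
    forall L, C <= L -> exists2 w, w <= C * L ^ 2 & forall j, j < L -> rep b 0 K (M * (w + j))].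
Proof.
move=> b_gt0.
have [C0 C0_gt0 H0] := rep_density 0 b_gt0.
have [C1 C1_gt0 H1] := rep_density 5 b_gt0.
(* The window of length [2 * L] will miss at most a proportion [4 * C1 / k] of its places; this [k]
   makes that at most [L / (2 * C0)] places, half of what the filling terms supply. *)
have [k Ek] : exists k, k = 16 * C0 * C1 by eexists.
have k_gt0 : 0 < k by rewrite Ek !muln_gt0 C0_gt0 C1_gt0.
(* Whichever of the [k] terms is selected later, its coefficient divides [M]. *)
pose M := \prod_(i < k) b (10 + i).
have M_gt0 : 0 < M by apply: prodn_gt0.
have [X0 HX0] := H0 M M_gt0; have [X1 HX1] := H1 M M_gt0.
pose g i : pred nat := fun v => `[<rep b 5 (10 + i) (M * v)>].
pose N X i := #|[pred v : 'I_X | g i v]|.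
have gmono i j v : i <= j -> g i v -> g j v.
  by move=> ij /asboolP Hi; apply/asboolP; apply: rep_widen Hi; lia.
have Nmono X : {homo N X : i j / i <= j}.
  by move=> i j ij; apply/subset_leq_card/fintype.subsetP => v; apply: gmono.
exists (10 + k), M, (39 * k * M + X0 + X1 + 2 * M + 1); split=> //; first by rewrite addn1.
move=> L HL.
have [LX0 LX1 LM L0] : [/\ X0 <= L, X1 <= L, 2 * M + 1 <= L & 0 < L] by split; lia.
pose W := 2 * L.
(* Large enough that three times the largest shift used is at most [X / k]; see [Q3]. *)
pose X := 9 * k * M * W ^ 2.
have LX : L <= X.
  rewrite /X /W; apply: (@leq_trans (1 * L ^ 2)); first by rewrite mul1n -mulnn leq_pmull.
  rewrite expnMn mulnA leq_mul2r; apply/orP; right; rewrite !muln_gt0 k_gt0 M_gt0 //.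
have [|i ik Hi] := @small_increment (N X) k X k_gt0 (Nmono X).
  by rewrite -[leqRHS](card_ord X); apply: max_card.
have N0 : X <= C1 * N X i.
  apply: leq_trans (HX1 X (leq_trans LX1 LX)) _; rewrite leq_mul2l; apply/orP; right.
  apply: leq_trans (Nmono X 0 i (leq0n i)); apply/subset_leq_card/fintype.subsetP => v.
  exact: id.
have N_gt0 : 0 < N X i.
  by have : 0 < C1 * N X i by [apply: leq_trans N0; apply: leq_trans LX]; rewrite muln_gt0 => /andP[].
pose c := b (10 + i).
have [e Me] : exists e, M = c * e.
  by exists (\prod_(j < k | j != Ordinal ik) b (10 + j)); rewrite /M (bigD1 (Ordinal ik)).
have e_gt0 : 0 < e by move: M_gt0; rewrite Me muln_gt0 => /andP[].
have c_gt0 : 0 < c by apply: b_gt0.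
have eM : e <= M by rewrite Me leq_pmull.
have step v x y : g i v -> c * triangular x = M * y -> g i.+1 (v + y).
  move=> /asboolP Hv Hx; apply/asboolP; rewrite addnS mulnDr -Hx; apply: rep_snoc => //; lia.
have Q3 : 3 * (W * (2 * e * W + 1)) * k <= X.
  rewrite /X (_ : 9 * k * M * W ^ 2 = 3 * (W * (3 * M * W)) * k); last by ring.
  by rewrite leq_mul2r leq_mul2l leq_mul2l; apply/orP; right; rewrite /W; nia.
have [||v z gv|v z gv||w wX Hw] := @full_window (g i) (g i.+1) e X W e_gt0.
- by rewrite /W; lia.
- by move=> v; apply: gmono.
- by apply: (step _ (2 * e * z)) => //; rewrite triangular_quad mulnA -Me.
- have [->|z0] := posnP z; first by rewrite mul0n addn0; apply: gmono gv.
  by apply: (step _ (2 * e * z - 1)) => //; rewrite triangular_quad_pred // mulnA -Me.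
- exact: N_gt0.
set bad := #|_| in Hw; rewrite -/(N X i) -/(N X i.+1) in Hw.
have Hbad : 2 * C0 * bad <= L.
  have : k * (bad * N X i) <= 4 * W * (C1 * N X i).
    apply: (@leq_trans (4 * W * X)); last by rewrite leq_mul2l N0 orbT.
    apply: leq_trans (leq_mul (leqnn k) Hw) _.
    rewrite (_ : 4 * W * X = W * (3 * X + X)); last by ring.
    rewrite mulnCA leq_mul2l; apply/orP; right; rewrite mulnDr; apply: leq_add.
      by rewrite mulnCA leq_mul2l Hi orbT.
    by rewrite mulnC.
  rewrite (mulnA k) (mulnA (4 * W)) leq_pmul2r // Ek /W.
  rewrite (_ : 16 * C0 * C1 * bad = 8 * C1 * (2 * C0 * bad)); last by ring.
  by rewrite (_ : 4 * (2 * L) * C1 = 8 * C1 * L) ?leq_pmul2l ?muln_gt0 ?C1_gt0 //; ring.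
exists (w + L).
  apply: (@leq_trans (39 * k * M * L ^ 2)); last by rewrite leq_mul2r; apply/orP; right; lia.
  apply: (@leq_trans (X + L + L)); first by lia.
  rewrite /X /W (_ : 39 * k * M * L ^ 2 = 9 * k * M * (2 * L) ^ 2 + 3 * (k * M) * L ^ 2); last by ring.
  rewrite -addnA leq_add2l; apply: (@leq_trans (2 * 1 * L ^ 2)); first by rewrite -mulnn; nia.
  by rewrite leq_mul2r; apply/orP; right; apply: leq_mul => //; rewrite muln_gt0 k_gt0.
move=> j jL.
pose V := [pred v : 'I_L | `[<rep b 0 5 (M * v)>]].
have HV : L <= C0 * #|V| by apply: HX0.
(* At least [L / C0] values [v] are available, and distinct [v] probe distinct places [L + j - v] of
   the window; they cannot all be bad. *)
have [v Vv gv] : exists2 v : 'I_L, V v & g i (w + (L + j - v)).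
  apply: contrapT => Hno.
  have : #|V| <= bad.
    have jW (v : 'I_L) : L + j - v < W by rewrite /W; lia.
    apply: (leq_card_inj_on (f := fun v : 'I_L => Ordinal (jW v))) => [v v' _ _|v Vv].
      by move=> /(congr1 val) /= E; apply: val_inj => /=; have := ltn_ord v; have := ltn_ord v'; lia.
    by apply/negP => gv; apply: Hno; exists v.
  by move=> HVb; have := leq_mul (leqnn (2 * C0)) HVb; lia.
move: Vv => /asboolP Vv.
have -> : M * (w + L + j) = M * v + M * (w + (L + j - v)).
  by rewrite -mulnDr; congr muln; have := ltn_ord v; lia.
apply: (@rep_cat _ _ 5); [lia|exact: Vv|].
by move: gv => /asboolP; apply: rep_widen; lia.
Qed.

(** Consecutive values of [c * quad M z] differ by a multiple of [c * M * z] up to a constant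
    factor, which is of the order of the square root of [c * M * m]. *)
Lemma greedy_quad (c M m : nat) : 0 < c -> 0 < M ->
  exists2 z, c * quad M z <= m & (m - c * quad M z) ^ 2 <= 25 * c * M * m.
Proof.
move=> c0 M0.
have [||z /andP[lez ltz]] := @between_values (fun z => c * quad M z) m.
- by rewrite muln0.
- by move=> z; rewrite /quad mulnCA leq_pmulr // muln_gt0 c0 addn1.
exists z => //; set r := m - _.
have Hr : r < c * (4 * M * z + 2 * M + 1).
  have E : c * quad M z.+1 = c * quad M z + c * (4 * M * z + 2 * M + 1) by rewrite /quad; ring.
  by rewrite /r; lia.
have [z0|z0] := posnP z.
  rewrite z0 muln0 add0n in Hr; have rm : r <= m by apply: leq_subr.
  rewrite -mulnn; apply: leq_mul => //.
  apply: leq_trans (ltnW Hr) _; nia.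
have Hr' : r <= 7 * (c * M * z).
  apply: leq_trans (ltnW Hr) _; rewrite (_ : 7 * _ = c * (7 * (M * z))); last by ring.
  by rewrite leq_mul2l; apply/orP; right; nia.
have : r ^ 2 <= (7 * (c * M * z)) ^ 2 by rewrite leq_sqr.
move=> /leq_trans; apply.
apply: (@leq_trans (25 * c * M * (c * (z * (2 * M * z))))).
  have -> : 25 * c * M * (c * (z * (2 * M * z))) = 50 * (c * M * z) ^ 2 by ring.
  by rewrite expnMn leq_mul2r orbT.
rewrite leq_mul2l; apply/orP; right; apply: leq_trans lez.
by rewrite /quad !leq_mul2l leq_addr !orbT.
Qed.

(** For [m] of size about [B * L ^ 2] a window of length [L] starts at some [w <= m]. Two greedy
    steps reduce [m - w] to the order of the fourth root of [m], which is below [L] once [L] is at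
    least [L0]. *)
Lemma rep_multiples (b : nat -> nat) : (forall i, 0 < b i) ->
  exists K M C, 0 < M /\ forall n, C <= n -> M %| n -> rep b 0 K n.
Proof.
move=> b_gt0; have [K [M [B [M_gt0 B_gt0 HB]]]] := rep_window b_gt0.
pose c := b K; pose c' := b K.+1.
have c_gt0 : 0 < c by apply: b_gt0.
have c'_gt0 : 0 < c' by apply: b_gt0.
have [A EA] : exists A, A = 25 * (c + c') * M by eexists.
have [L0 EL0] : exists L0, L0 = B + 4 * A ^ 3 * B + 1 by eexists.
have [BL0 AL0 L0_gt0] : [/\ B <= L0, 4 * A ^ 3 * B <= L0 & 0 < L0] by rewrite EL0; split; lia.
exists K.+2, M, (M * (B * L0 ^ 2)); split=> // n Hn /dvdnP[m En].
move: Hn; rewrite {n}En [m * M]mulnC leq_pmul2l // => Hn.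
have [||L /andP[Lle Llt]] := @between_values (fun L => B * L ^ 2) m.
- by rewrite muln0.
- by move=> z; apply: (@leq_trans (1 * z ^ 2)); [rewrite mul1n -mulnn; nia|rewrite leq_mul2r B_gt0 orbT].
have L0L : L0 <= L.
  have : B * L0 ^ 2 < B * L.+1 ^ 2 by apply: leq_ltn_trans Llt.
  by rewrite ltn_pmul2l // ltn_sqr.
have [|w wL Hw] := HB L; first exact: leq_trans L0L.
have wm : w <= m by apply: leq_trans wL Lle.
have [z1 Hz1 Hr1] := greedy_quad (m - w) c_gt0 M_gt0; set r1 := _ - _ in Hr1.
have [z2 Hz2 Hr2] := greedy_quad r1 c'_gt0 M_gt0; set r2 := _ - _ in Hr2.
have r2L : r2 < L.
  have H1 : r1 ^ 2 <= A * m.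
    apply: leq_trans Hr1 _; apply: leq_mul; last exact: leq_subr.
    by rewrite EA leq_mul2r leq_mul2l leq_addr !orbT.
  have H2 : r2 ^ 2 <= A * r1.
    apply: leq_trans Hr2 _; apply: leq_mul => //.
    by rewrite EA leq_mul2r leq_mul2l leq_addl !orbT.
  have L_gt0 : 0 < L by apply: leq_trans L0L.
  have A_gt0 : 0 < A by rewrite EA !muln_gt0 M_gt0 addn_gt0 c_gt0.
  rewrite -ltn_sqr -ltn_sqr.
  have : (r2 ^ 2) ^ 2 <= A ^ 2 * (A * m).
    apply: (@leq_trans ((A * r1) ^ 2)); first by rewrite leq_sqr.
    by rewrite expnMn leq_mul2l H1 orbT.
  move=> /leq_ltn_trans; apply.
  apply: (@leq_trans (A ^ 2 * (A * (B * L.+1 ^ 2)))).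
    by rewrite !ltn_pmul2l ?expn_gt0 ?A_gt0.
  apply: (@leq_trans (A ^ 2 * (A * (B * (4 * L ^ 2))))).
    by rewrite !leq_mul2l -[4]/(2 ^ 2) -expnMn leq_sqr; lia.
  rewrite (_ : A ^ 2 * _ = (4 * A ^ 3 * B) * L ^ 2); last by ring.
  rewrite -[leqRHS]mulnn leq_mul2r; apply/orP; right.
  apply: (@leq_trans L); first exact: leq_trans L0L.
  by rewrite -mulnn leq_pmull.
have -> : M * m = M * (w + r2) + c * triangular (2 * M * z1) + c' * triangular (2 * M * z2).
  rewrite !triangular_quad.
  have E1 : r1 + c * quad M z1 = m - w by rewrite /r1 subnK.
  have E2 : r2 + c' * quad M z2 = r1 by rewrite /r2 subnK.
  clearbody r1 r2; rewrite -(subnKC wm) -E1 -E2; ring.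
by apply: rep_snoc => //; apply: rep_snoc => //; apply: Hw.
Qed.

(** * Congruences *)

Definition locrep (b : nat -> nat) (J m n : nat) : Prop :=
  exists x : nat -> nat, \sum_(0 <= i < J) b i * triangular (x i) = n %[mod m].

Lemma locrep_widen b J J' m n : J <= J' -> locrep b J m n -> locrep b J' m n.
Proof.
move=> JJ [x Ex]; exists (fun i => if i < J then x i else 0).
rewrite (big_cat_nat (leq0n J) JJ) /= [X in _ + X]big1_seq ?addn0.
  rewrite -Ex; congr modn; apply: eq_big_nat => i /andP[_ ->] //.
by move=> i; rewrite mem_index_iota => /andP[_ /andP[]]; rewrite leqNgt => /negbTE ->; rewrite muln0.
Qed.

Lemma eqmod_dvd d d' m n : d' %| d -> m = n %[mod d] -> m = n %[mod d'].
Proof. by move=> dd E; rewrite -(modn_dvdm m dd) E modn_dvdm. Qed.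

Lemma eqmodP (m n d : nat) : (exists k : int, (m%:Z - n%:Z = k * d%:Z)%R) <-> m = n %[mod d].
Proof.
split=> [[k E]|E].
  have : (m%:Z == n%:Z %[mod d%:Z])%Z by rewrite eqz_mod_dvd E dvdz_mull.
  by rewrite !modz_nat => /eqP[].
have : (m%:Z == n%:Z %[mod d%:Z])%Z by rewrite !modz_nat E.
by rewrite eqz_mod_dvd => /dvdzP.
Qed.

Lemma eqmodD d m m' n n' : m = m' %[mod d] -> n = n' %[mod d] -> m + n = m' + n' %[mod d].
Proof. by move=> E E'; rewrite -modnDm E E' modnDm. Qed.

Lemma eqmodM d m m' n n' : m = m' %[mod d] -> n = n' %[mod d] -> m * n = m' * n' %[mod d].
Proof. by move=> E E'; rewrite -modnMm E E' modnMm. Qed.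

Lemma eqmod_cancel m c A B : coprime m c -> c * A = c * B %[mod m] -> A = B %[mod m].
Proof.
move=> cop /eqmodP[k Ek]; apply/eqmodP.
have : (m%:Z %| c%:Z * (A%:Z - B%:Z))%Z%R.
  by apply/dvdzP; exists k; rewrite -Ek !PoszM; ring.
by rewrite Gauss_dvdzr => [/dvdzP|].
Qed.

Lemma eqmodX d m m' k : m = m' %[mod d] -> m ^ k = m' ^ k %[mod d].
Proof. by move=> E; rewrite -modnXm E modnXm. Qed.

Lemma eqmod_sum d (I : eqType) (r : seq I) (F F' : I -> nat) :
  (forall i, i \in r -> F i = F' i %[mod d]) -> \sum_(i <- r) F i = \sum_(i <- r) F' i %[mod d].
Proof.
elim: r => [|i r IH] E; rewrite ?big_nil // !big_cons; apply: eqmodD; first by apply/E/mem_head.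
by apply: IH => j jr; apply: E; rewrite inE jr orbT.
Qed.

Lemma coprime_inverse u n : 0 < n -> coprime u n -> exists c, c * u = 1 %[mod n].
Proof.
move=> n0 cop; exists (u ^ (totient n).-1).
by rewrite -expnSr prednK ?totient_gt0 // Euler_exp_totient.
Qed.

(** * Solutions modulo prime powers *)

(** Lifting from [2 ^ a] to [2 ^ a.+1]: adding [2 ^ a.+1] to [x] changes [triangular x] by [2 ^ a]
    times an odd number. *)
Lemma triangular_mod_pow2 u a n : odd u -> exists x, u * triangular x = n %[mod 2 ^ a].
Proof.
move=> ou; elim: a => [|a [x /eqmodP[k Ek]]]; first by exists 0; rewrite !modn1.
have [ek|ok] := boolP (2 %| k)%Z.
  exists x; apply/eqmodP; exists (k %/ 2)%Z.
  by rewrite Ek expnS PoszM GRing.mulrA divzK.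
exists (x + 2 ^ a.+1); apply/eqmodP.
have E : triangular (x + 2 ^ a.+1) = triangular x + 2 ^ a * (2 * x + 2 ^ a.+1 + 1).
  apply/eqP; rewrite -(eqn_pmul2l (isT : 0 < 2)) mulnDr !triangular2 expnS; apply/eqP; ring.
have [l El] : exists l : int, (k + u%:Z = l * 2)%R.
  by apply/dvdzP; move: ok ou; lia.
exists (l + u%:Z * (x%:Z + (2 ^ a)%N%:Z))%R.
rewrite E mulnDr PoszD GRing.addrAC Ek expnS !(PoszM, PoszD).
transitivity ((k + u%:Z) * (2 ^ a)%N%:Z + u%:Z * (2 * x%:Z + 2 * (2 ^ a)%N%:Z) * (2 ^ a)%N%:Z)%R.
  by ring.
by rewrite El; ring.
Qed.

(** Each [p]-th power gains a factor [p]: in [w ^ p - 1 = (w - 1) * (1 + w + ... + w ^ (p - 1))] the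
    second factor is a sum of [p] terms congruent to [1] modulo [p]. *)
Lemma exp_prime_power_mod p a z : prime p -> z = 1 %[mod p] -> z ^ (p ^ a) = 1 %[mod p ^ a.+1].
Proof.
move=> pp z1; have p1 := prime_gt1 pp.
have z0 : 0 < z by case: z z1 => // /eqP; rewrite mod0n modn_small.
elim: a => [|a IH]; first by rewrite expn0 !expn1.
set w := z ^ (p ^ a) in IH.
have w0 : 0 < w by rewrite expn_gt0 z0.
rewrite expnSr expnM -/w; apply/eqP; rewrite eqn_mod_dvd ?(expn_gt0 w) ?w0 // subn1 predn_exp.
rewrite expnSr dvdn_mul //; first by rewrite -subn1 -eqn_mod_dvd //; apply/eqP.
have w1 : w = 1 %[mod p] by apply: eqmod_dvd IH; rewrite expnS dvdn_mulr.
have -> : p %| \sum_(i < p) w ^ i = (p %| \sum_(i < p) 1).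
  by congr (_ == _); apply: eqmod_sum => i _; rewrite (eqmodX i w1) exp1n.
by rewrite sum1_card card_ord.
Qed.

(* Modulo [p ^ a.+1] the residue [z = x / y] lies in a group of odd order [p ^ a], *)
(* so [z ^ ((p ^ a + 1) / 2)] is a square root of it. *)
Lemma square_mod_prime_power p a x y : prime p -> odd p -> coprime y p -> x = y %[mod p] ->
  exists Y, y * Y ^ 2 = x %[mod p ^ a.+1].
Proof.
move=> pp op cop xy; have p0 := prime_gt0 pp.
have [|c Ec] := @coprime_inverse y (p ^ a.+1) _ (coprimeXr _ cop); first by rewrite expn_gt0 p0.
pose z := x * c.
have z1 : z = 1 %[mod p].
  rewrite -(eqmod_dvd _ Ec) ?expnS ?dvdn_mulr // mulnC.
  exact: eqmodM.
exists (z ^ (p ^ a).+1./2).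
have -> : (z ^ (p ^ a).+1./2) ^ 2 = z * z ^ (p ^ a).
  rewrite -expnM muln2 -expnS; congr (_ ^ _).
  by have := odd_double_half (p ^ a).+1; rewrite /= oddX op orbT /= add0n.
rewrite mulnA -modnMmr (exp_prime_power_mod a pp z1) modnMmr muln1 /z mulnCA (mulnC y).
by rewrite -modnMmr Ec modnMmr muln1.
Qed.

Lemma eventually_all (Q : nat -> nat -> Prop) m :
  (forall i, i < m -> exists N, forall j, N <= j -> Q i j) ->
  exists N, forall i, i < m -> forall j, N <= j -> Q i j.
Proof.
elim: m => [|m IH] H; first by exists 0.
have [N HN] := IH (fun i im => H i (ltnW im)); have [N' HN'] := H m (ltnSn m).
exists (maxn N N') => i; rewrite ltnS leq_eqVlt => /predU1P[->|im] j; rewrite geq_max => /andP[Nj N'j].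
  exact: HN'.
exact: HN.
Qed.

Definition infinitely_often (P : nat -> Prop) : Prop := forall N, exists2 i, N <= i & P i.

Lemma infinite_pigeonhole (P : nat -> Prop) (f : nat -> nat) m :
  infinitely_often P -> (forall i, f i < m) ->
  exists k, infinitely_often (fun i => P i /\ f i = k).
Proof.
move=> Pinf fm; apply: contrapT => H.
have [|N HN] := @eventually_all (fun k i => ~ (P i /\ f i = k)) m.
  move=> k _; apply: contrapT => Hk; apply: H; exists k => N; apply: contrapT => HN.
  by apply: Hk; exists N => j Nj Hj; apply: HN; exists j.
by have [i Ni Pi] := Pinf N; apply: (HN (f i) (fm i) i Ni).
Qed.

Lemma minimal_beyond (f : nat -> nat) N : exists2 i, N <= i & forall j, N <= j -> f i <= f j.
Proof.
have H : exists v, `[<exists2 i, N <= i & f i = v>] by exists (f N); apply/asboolP; exists N.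
case: (ex_minnP H) => v /asboolP[i Ni fi] vmin; exists i => // j Nj.
by rewrite fi; apply: vmin; apply/asboolP; exists j.
Qed.

Lemma sum_ord_split (J : nat) (s : seq nat) (F : nat -> nat) :
  uniq s -> (forall i, i \in s -> i < J) ->
  \sum_(0 <= i < J) F i = \sum_(i <- s) F i + \sum_(0 <= i < J | i \notin s) F i.
Proof.
move=> us sJ; rewrite (bigID (mem s)) /=; congr addn.
rewrite -big_filter; apply: perm_big; apply: uniq_perm => //; first by rewrite filter_uniq ?iota_uniq.
by move=> i; rewrite mem_filter mem_index_iota /= andbC; case: (boolP (i \in s)) => [/sJ ->|]; rewrite ?andbF.
Qed.

Lemma square_triangular t : 8 * triangular t + 1 = (2 * t + 1) ^ 2.
Proof.
have -> : 8 * triangular t = 4 * (2 * triangular t) by ring.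
by rewrite triangular2; ring.
Qed.

(* Completing the square: [8 T_x + 1 = (2x + 1) ^ 2]; modulo an odd prime power *)
(* the odd number [2x + 1] is arbitrary. *)
Lemma locrep_of_squares b J p a n (X : nat -> nat) : prime p -> odd p ->
  \sum_(0 <= i < J) b i * X i ^ 2 = 8 * n + \sum_(0 <= i < J) b i %[mod p ^ a] ->
  locrep b J (p ^ a) n.
Proof.
move=> pp op E; have opa : odd (p ^ a) by rewrite oddX op orbT.
pose x i := (if odd (X i) then X i else X i + p ^ a)./2.
have xE i : 2 * x i + 1 = X i %[mod p ^ a].
  have -> : 2 * x i + 1 = if odd (X i) then X i else X i + p ^ a.
    rewrite /x; case: ifPn => o.
      by have := odd_double_half (X i); rewrite o; lia.
    by have := odd_double_half (X i + p ^ a); rewrite oddD (negbTE o) opa; lia.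
  by case: ifP => _ //; rewrite modnDr.
exists x.
have S : 8 * \sum_(0 <= i < J) b i * triangular (x i) + \sum_(0 <= i < J) b i
    = \sum_(0 <= i < J) b i * (2 * x i + 1) ^ 2.
  rewrite big_distrr -big_split; apply: eq_bigr => i _ /=.
  by rewrite -square_triangular; ring.
have cop8 : coprime (p ^ a) 8 by rewrite -[8]/(2 ^ 3) coprimeXr // coprime_sym coprime2n.
apply: (eqmod_cancel cop8); apply/eqP; rewrite -(eqn_modDr (\sum_(0 <= i < J) b i)); apply/eqP.
by rewrite S -E; apply: eqmod_sum => i _; apply: eqmodM => //; apply: eqmodX.
Qed.

(** A coefficient of least 2-adic valuation [v] suffices: [2 ^ v] divides everything represented,
    and an odd multiple of a triangular number takes all residues modulo [2 ^ a]. *)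
Lemma locrep_pow2 b : (forall i, 0 < b i) ->
  exists J, forall a K n, rep b 0 K n -> locrep b J (2 ^ a) n.
Proof.
move=> b_gt0; have [i _ imin] := minimal_beyond (fun i => logn 2 (b i)) 0.
exists i.+1 => a K n [x En]; set v := logn 2 (b i) in imin.
have vb j : 2 ^ v %| b j by rewrite pfactor_dvdn // imin.
have [n' En'] : exists n', n = n' * 2 ^ v.
  by apply/dvdnP; rewrite En; apply: dvdn_sum => j _; rewrite dvdn_mulr.
have [u Eu] := dvdnP (vb i).
have ou : odd u.
  rewrite -[odd u]negbK -dvdn2; apply/negP => /dvdnP[u' Eu'].
  have : 2 ^ v.+1 %| b i by rewrite Eu Eu' -mulnA -expnS dvdn_mull.
  by rewrite pfactor_dvdn // ltnn.
have [t Ht] := triangular_mod_pow2 a n' ou.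
exists (fun j => if j == i then t else 0).
rewrite big_nat_recr //= eqxx big1_seq ?add0n.
  rewrite Eu En' mulnAC; exact: eqmodM.
by move=> j; rewrite mem_index_iota => /andP[_ ji]; rewrite ltn_eqF ?muln0.
Qed.

(* Infinitely many [b i] share the parity of the valuation and the leading digit; [r.+1] of them *)
(* are listed with the largest valuation at [i0]; that power of [p] eventually divides the sequence. *)
Lemma similar_coefficients (b : nat -> nat) p r : (forall i, 0 < b i) -> prime p ->
  exists i0 s N u, [/\ uniq (i0 :: s), size s = r, coprime u p,
    forall j, N <= j -> p ^ logn p (b i0) %| b j
  & forall i, i \in i0 :: s -> exists k v,
      [/\ b i = p ^ k * v, k + 2 * ((logn p (b i0) - k)./2) = logn p (b i0) & v = u %[mod p]]].
Proof.
move=> b_gt0 pp; have p_gt1 := prime_gt1 pp; have p_gt0 := ltnW p_gt1.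
pose val i := logn p (b i); pose unit i := b i %/ p ^ val i.
have bE i : b i = p ^ val i * unit i by rewrite mulnC divnK // pfactor_dvdnn.
have cop i : coprime (unit i) p.
  have [|m pm Em] := @pfactor_coprime p (b i) pp; first exact: b_gt0.
  by rewrite /unit {1}Em mulnK ?expn_gt0 ?p_gt0 // coprime_sym.
pose P i := exists N, forall j, N <= j -> p ^ val i %| b j.
have Pinf : infinitely_often P.
  move=> N; have [i Ni imin] := minimal_beyond val N; exists i => //; exists N => j Nj.
  by rewrite pfactor_dvdn // imin.
pose key i := 2 * (unit i %% p) + odd (val i).
have [|k0 Hk0] := infinite_pigeonhole (m := 2 * p) (f := key) Pinf.
  by move=> i; rewrite /key; have := ltn_pmod (unit i) p_gt0; case: (odd _); lia.
have keyE i j : key i = key j -> odd (val i) = odd (val j) /\ unit i = unit j %[mod p].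
  by rewrite /key; case: (odd (val i)); case: (odd (val j)); lia.
have [i0 [s [us ss Hs]]] : exists i0 s, [/\ uniq (i0 :: s), size s = r &
    forall i, i \in i0 :: s -> [/\ P i, key i = k0 & val i <= val i0]].
  elim: r => [|r [i0 [s [us ss Hs]]]].
    have [i _ [Pi ki]] := Hk0 0; exists i, [::]; split=> // j; rewrite inE => /eqP ->.
    by split.
  have [[N HN] _ _] := Hs i0 (mem_head _ _).
  (* Beyond [N] the valuation is at least that of the old head [i0], so the index found becomes the
     new head; beyond the listed indices it is new. *)
  have [i] := Hk0 (maxn N (\max_(j <- i0 :: s) j).+1); rewrite geq_max => /andP[Ni mi] [Pi ki].
  have vi : val i0 <= val i by rewrite -pfactor_dvdn // HN.
  exists i, (i0 :: s); split.
  - rewrite cons_uniq us andbT; apply/negP => Hi.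
    by have := @leq_bigmax_seq _ (i0 :: s) predT id i Hi isT; rewrite /= leqNgt mi.
  - by rewrite /= ss.
  move=> j; rewrite inE => /predU1P[->|js]; first by split.
  by have [Pj kj vj] := Hs j js; split=> //; apply: leq_trans vi.
have [[N HN] k0E _] := Hs i0 (mem_head _ _).
exists i0, s, N, (unit i0); split=> // i /Hs[_ ki vi].
have [oi ui] : odd (val i) = odd (val i0) /\ unit i = unit i0 %[mod p] by apply: keyE; rewrite ki.
exists (val i), (unit i); split=> //.
have := odd_double_half (val i0 - val i); rewrite oddB // oi addbb -/(val i0) => E.
by move: E vi; rewrite add0n -mul2n => -> vi; rewrite subnKC.
Qed.

(** Scaling each variable by a power of [p] turns the coefficients into [p ^ w * v] with [v]
    congruent to [u]. Setting [m] scaled variables to [1] leaves for [i0] a target congruent to [u],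
    which a square can reach. *)
Lemma quadratic_multiples (b : nat -> nat) p i0 s u w : prime p -> odd p ->
  uniq (i0 :: s) -> size s = p.-1 -> coprime u p ->
  (forall i, i \in i0 :: s -> exists k v, [/\ b i = p ^ k * v, k + 2 * ((w - k)./2) = w & v = u %[mod p]]) ->
  forall a t, p ^ w %| t ->
  exists X : nat -> nat, \sum_(i <- i0 :: s) b i * X i ^ 2 = t %[mod p ^ a.+1].
Proof.
move=> pp op us ss cop Hb a t /dvdnP[t' Et].
have p_gt1 := prime_gt1 pp; have p_gt0 := ltnW p_gt1.
have {}Hb i : exists Xv, i \in i0 :: s -> b i * Xv.1 ^ 2 = p ^ w * Xv.2 /\ Xv.2 = u %[mod p].
  have [/Hb [k [v [Ei kw vu]]]|_] := boolP (i \in i0 :: s); last by exists (0, 0).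
  exists (p ^ ((w - k)./2), v) => _; split=> //=.
  by rewrite Ei -expnM mulnAC -expnD (mulnC _ 2) kw.
have /choice [g Hg] := Hb; pose X i := (g i).1; pose v i := (g i).2.
have {Hg Hb} [HX Hv] : (forall i, i \in i0 :: s -> b i * X i ^ 2 = p ^ w * v i)
    /\ (forall i, i \in i0 :: s -> v i = u %[mod p]).
  by split=> i /(Hg i)[].
have [c Ec] := coprime_inverse p_gt0 cop.
(* [m.+1] is [t' / u] modulo [p]: [m] ones from [s], and one more unit for [i0]. *)
pose m := (t' * c + p.-1) %% p.
have mp : m <= p.-1 by rewrite -ltnS prednK // ltn_pmod.
have Em : m.+1 * u = t' %[mod p].
  have E1 : m.+1 = t' * c %[mod p].
    by rewrite -addn1 /m modnDml -addnA addn1 prednK // modnDr.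
  rewrite (eqmodM E1 (erefl (u %% p))) -mulnA.
  by rewrite (eqmodM (erefl (t' %% p)) Ec) muln1.
pose ones := take m s.
have ones_sub i : i \in ones -> i \in i0 :: s by move=> /mem_take is_; rewrite inE is_ orbT.
pose S := \sum_(i <- ones) v i.
have ES : S = m * u %[mod p].
  have -> : m * u = \sum_(i <- ones) u.
    by rewrite big_const_seq count_predT size_take ss iter_addn_0 mulnC; case: ltngtP mp => // ->.
  by apply: eqmod_sum => i /ones_sub/Hv.
(* The added multiple of [p ^ a.+1] keeps the subtraction of [S] within the natural numbers. *)
have [Y HY] : exists Y, v i0 * Y ^ 2 = t' + p ^ a.+1 * S - S %[mod p ^ a.+1].
  apply: square_mod_prime_power => //.
    by rewrite /coprime -gcdn_modl (Hv i0 (mem_head _ _)) gcdn_modl.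
  have St : S <= t' + p ^ a.+1 * S by rewrite (leq_trans _ (leq_addl _ _)) // leq_pmull // expn_gt0 p_gt0.
  apply/eqP; rewrite -(eqn_modDr S) subnK //; apply/eqP.
  rewrite -modnDmr (_ : p ^ a.+1 * S %% p = 0) ?addn0; last by rewrite expnS -mulnA modnMr.
  rewrite -Em mulSn; apply: eqmodD; [by rewrite (Hv i0 (mem_head _ _))|by rewrite ES].
exists (fun i => if i == i0 then Y * X i0 else if i \in ones then X i else 0).
rewrite big_cons eqxx expnMn mulnCA HX ?mem_head //.
move: us; rewrite cons_uniq => /andP[i0s us].
have -> : \sum_(i <- s) b i * (if i == i0 then Y * X i0 else if i \in ones then X i else 0) ^ 2
    = p ^ w * S.
  rewrite -{1}(cat_take_drop m s) big_cat /= [X in _ + X]big1_seq ?addn0.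
    rewrite /S big_distrr; apply: eq_big_seq => i io /=.
    have is_ : i \in s := mem_take io.
    by rewrite io; case: eqP i0s => [<-|_ _]; [rewrite is_|rewrite HX // ones_sub].
  move=> i /andP[_ id_]; have is_ : i \in s := mem_drop id_.
  case: eqP i0s => [<-|_ _]; first by rewrite is_.
  move: us; rewrite -{1}(cat_take_drop m s) cat_uniq => /and3P[_ /hasPn/(_ i id_) /negbTE io _].
  by rewrite /ones io exp0n // muln0.
rewrite Et (mulnC t') mulnCA -mulnDr; apply: eqmodM => //.
rewrite mulnC (eqmodD HY (erefl (S %% _))) subnK; last first.
  by rewrite (leq_trans _ (leq_addl _ _)) // leq_pmull // expn_gt0 p_gt0.
by rewrite -modnDmr modnMr addn0.
Qed.

Lemma locrep_odd b p : (forall i, 0 < b i) -> prime p -> odd p ->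
  exists J, forall a K n, rep b 0 K n -> locrep b J (p ^ a) n.
Proof.
move=> b_gt0 pp op; have p_gt1 := prime_gt1 pp; have p_gt0 := ltnW p_gt1.
have [i0 [s [N [u [us ss cop HN Hb]]]]] := similar_coefficients p.-1 b_gt0 pp.
set w := logn p (b i0) in HN Hb.
pose J := maxn N (\max_(j <- i0 :: s) j).+1.
have sJ i : i \in i0 :: s -> i < J.
  by move=> Hi; rewrite /J leq_max ltnS (@leq_bigmax_seq _ (i0 :: s) predT id i Hi isT) orbT.
exists J => a K n Hn.
(* Terms from [N] on are divisible by [p ^ w], so altering the first [J] variables only has to
   absorb a multiple of [p ^ w]. *)
have [A [x [EA [q Eq]]]] : exists A (x : nat -> nat), A = \sum_(0 <= i < J) b i * triangular (x i) /\
    exists q, n = A + p ^ w * q.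
  have /(@rep_widen b 0 0 K (maxn J K)) [] : rep b 0 K n by [].
  - by rewrite leq0n.
  - exact: leq_maxr.
  move=> x ->; exists (\sum_(0 <= i < J) b i * triangular (x i)), x; split=> //.
  have : p ^ w %| \sum_(J <= i < maxn J K) b i * triangular (x i).
    rewrite big_seq; apply: dvdn_sum => i; rewrite mem_index_iota => /andP[Ji _].
    by rewrite dvdn_mulr // HN // (leq_trans _ Ji) // leq_maxl.
  move=> /dvdnP[q Eq]; exists q.
  by rewrite (big_cat_nat (leq0n J) (leq_maxl _ _)) /= Eq mulnC.
pose X i := 2 * x i + 1.
suff [r [Z [ur rJ EZ]]] : exists r (Z : nat -> nat), [/\ uniq r, forall i, i \in r -> i < J &
    \sum_(i <- r) b i * Z i ^ 2 = \sum_(i <- r) b i * X i ^ 2 + 8 * (p ^ w * q) %[mod p ^ a.+1]].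
  have [y Ey] : locrep b J (p ^ a.+1) n.
    apply: (locrep_of_squares (X := fun i => if i \in r then Z i else X i)) => //.
    have SX : \sum_(0 <= i < J) b i * X i ^ 2 = 8 * A + \sum_(0 <= i < J) b i.
      rewrite EA big_distrr -big_split; apply: eq_bigr => i _ /=.
      by rewrite /X -(square_triangular (x i)); ring.
    rewrite (sum_ord_split _ ur rJ).
    have -> : \sum_(i <- r) b i * (if i \in r then Z i else X i) ^ 2 = \sum_(i <- r) b i * Z i ^ 2.
      by apply: eq_big_seq => i ->.
    have -> : \sum_(0 <= i < J | i \notin r) b i * (if i \in r then Z i else X i) ^ 2
        = \sum_(0 <= i < J | i \notin r) b i * X i ^ 2.
      by apply: eq_bigr => i /negbTE ->.
    rewrite (eqmodD EZ (erefl _)) addnAC -(sum_ord_split _ ur rJ) SX Eq; congr (_ %% _); ring.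
  by exists y; apply: eqmod_dvd Ey; rewrite expnS dvdn_mull.
(* If [p ^ w] divides every listed square term, these terms are solved anew together. Otherwise one
   of them has smaller valuation and absorbs the correction alone, through a square root. *)
have [/allP Hall|/allPn [i ir Hi]] := boolP (all (fun i => p ^ w %| b i * X i ^ 2) (i0 :: s)).
  have [|Z EZ] := quadratic_multiples pp op us ss cop Hb a
      (t := \sum_(i <- i0 :: s) b i * X i ^ 2 + 8 * (p ^ w * q)).
    apply: dvdn_add; last by rewrite mulnCA dvdn_mulr.
    by rewrite big_seq; apply: dvdn_sum => i /Hall.
  by exists (i0 :: s), Z; split.
have BX_gt0 : 0 < b i * X i ^ 2 by rewrite muln_gt0 b_gt0 expn_gt0 /X addn1.
have [y cy Ey] := pfactor_coprime pp BX_gt0.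
set v := logn p _ in Ey.
have vw : v < w by rewrite ltnNge; apply: contra Hi => wv; rewrite Ey dvdn_mull // dvdn_exp2l.
have [Y EY] : exists Y, y * Y ^ 2 = y + 8 * (p ^ (w - v) * q) %[mod p ^ a.+1].
  apply: square_mod_prime_power => //; first by rewrite coprime_sym.
  rewrite -(subnSK vw) expnS -modnDmr (_ : 8 * _ %% p = 0) ?addn0 //.
  by rewrite -mulnA mulnCA modnMr.
exists [:: i], (fun i => X i * Y); split=> // [j|]; first by rewrite inE => /eqP ->; apply: sJ.
rewrite !big_seq1 expnMn mulnA Ey -(subnK (ltnW vw)) expnD.
transitivity (p ^ v * (y + 8 * (p ^ (w - v) * q)) %% p ^ a.+1); last by congr (_ %% _); ring.
rewrite (mulnC y) -mulnA; exact: eqmodM.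
Qed.

Lemma locrep_prime b p : (forall i, 0 < b i) -> prime p ->
  exists J, forall a K n, rep b 0 K n -> locrep b J (p ^ a) n.
Proof.
move=> b_gt0 pp; have [->|op] := even_prime pp; first exact: locrep_pow2.
exact: locrep_odd.
Qed.

(** * From congruences to representations *)

Lemma triangular_mod_odd m x y : odd m -> x = y %[mod m] -> triangular x = triangular y %[mod m].
Proof.
move=> om xy; apply: (@eqmod_cancel _ 2); first by rewrite coprimen2.
by rewrite !triangular2; apply: eqmodM => //; apply: eqmodD.
Qed.

Lemma triangular_mod m x y : x = y %[mod 2 * m] -> triangular x = triangular y %[mod m].
Proof.
move=> xy; apply/eqP; rewrite -(eqn_pmul2l (isT : 0 < 2)) !muln_modr !triangular2; apply/eqP.
by apply: eqmodM => //; apply: eqmodD.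
Qed.

(** Chinese remainders for the arguments: [triangular x] is determined modulo the odd [m1] by [x]
    modulo [m1], but modulo [m2] by [x] modulo [2 * m2]. *)
Lemma locrep_coprime b J m1 m2 n : odd m1 -> coprime m1 m2 ->
  locrep b J m1 n -> locrep b J m2 n -> locrep b J (m1 * m2) n.
Proof.
move=> om1 cop [x Ex] [y Ey].
have cop2 : coprime m1 (2 * m2) by rewrite coprimeMr coprimen2 om1.
exists (fun i => chinese m1 (2 * m2) (x i) (y i)).
apply/eqP; rewrite chinese_remainder //; apply/andP; split; apply/eqP.
  rewrite -Ex; apply: eqmod_sum => i _; apply: eqmodM => //; apply: triangular_mod_odd => //.
  exact: chinese_modl.
rewrite -Ey; apply: eqmod_sum => i _; apply: eqmodM => //; apply: triangular_mod.
exact: chinese_modr.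
Qed.

Lemma locrep_of_prime_powers b J M n : 0 < M ->
  (forall p a, prime p -> locrep b J (p ^ a) n) -> locrep b J M n.
Proof.
move=> M0 Hp; elim/ltn_ind: M M0 => M IH M0.
have [M1|M1] := leqP M 1.
  by exists (fun=> 0); have -> : M = 1 by [lia]; rewrite !modn1.
have pp := pdiv_prime M1; set p := pdiv M in pp.
have [m cop EM] := pfactor_coprime pp M0.
have m0 : 0 < m by move: M0; rewrite EM muln_gt0 => /andP[].
have l0 : 0 < logn p M by rewrite logn_gt0 mem_primes pp M0 pdiv_dvd.
have mM : m < M.
  by rewrite [ltnRHS]EM -[ltnLHS]muln1 ltn_pmul2l // -(expn0 p) ltn_exp2l // prime_gt1.
have Hm := IH m mM m0; have Hpa := Hp p (logn p M) pp.
have copm : coprime m (p ^ logn p M) by rewrite coprimeXr // coprime_sym.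
(* Of two coprime factors at least one is odd, and [locrep_coprime] wants it first. *)
rewrite EM; have [om|em] := boolP (odd m); first exact: locrep_coprime.
rewrite mulnC; apply: locrep_coprime; rewrite // 1?coprime_sym //.
rewrite oddX; apply/orP; right; have [p2|//] := even_prime pp.
by move: cop; rewrite p2 coprime2n (negbTE em).
Qed.

Lemma triangular_homo x y : x <= y -> triangular x <= triangular y.
Proof. by move=> xy; rewrite -(leq_pmul2l (isT : 0 < 2)) !triangular2 leq_mul // leq_add2r. Qed.

(** A large [n] splits into a value of the first [J] terms in its class modulo [M1] and a large
    multiple of [M1] from the tail; finitely many small [n] remain. *)
Lemma rep_stable b : (forall i, 0 < b i) ->
  exists N, forall K n, rep b 0 K n -> rep b 0 N n.
Proof.
move=> b_gt0.
have [K0 [M0 [C0 [M0_gt0 H0]]]] := rep_multiples b_gt0.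
have [J0 HJ0] : exists N, forall p, p < M0.+1 -> forall J, N <= J -> prime p ->
    forall a K n, rep b 0 K n -> locrep b J (p ^ a) n.
  apply: (eventually_all (Q := fun p J => prime p ->
    forall a K n, rep b 0 K n -> locrep b J (p ^ a) n)) => p _.
  have [pp|npp] := boolP (prime p); last by exists 0.
  have [N HN] := locrep_prime b_gt0 pp; exists N => J NJ _ a K n Hn.
  by apply: locrep_widen NJ _; apply: HN Hn.
pose J := maxn K0 J0.
have Hloc p a K n : prime p -> rep b 0 K n -> locrep b J (p ^ a) n.
  move=> pp Hn; have [pM|pM] := ltnP p M0.+1.
    by apply: (HJ0 p pM J _ pp a K n Hn); apply: leq_maxr.
  (* A prime above [M0] does not divide it, so some large multiple of [M0] is congruent to [n]
     modulo [p ^ a]; the first [K0] terms represent it. *)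
  have cop : coprime (p ^ a) M0.
    rewrite coprimeXl // prime_coprime //; apply/negP => /(dvdn_leq M0_gt0).
    by rewrite leqNgt pM.
  have pa_gt0 : 0 < p ^ a by rewrite expn_gt0 prime_gt0.
  pose n' := chinese (p ^ a) M0 n 0 + C0 * (p ^ a * M0).
  have [||x Ex] := H0 n'.
  - by rewrite /n' (leq_trans _ (leq_addl _ _)) // leq_pmulr // muln_gt0 pa_gt0.
  - rewrite dvdn_add ?mulnA ?dvdn_mull //.
    by rewrite /dvdn chinese_modr // mod0n.
  apply: (locrep_widen (leq_maxl K0 J0)); exists x; rewrite -Ex /n'.
  rewrite (mulnC (p ^ a)) mulnA -modnDmr modnMl addn0; exact: chinese_modl.
have [K1 [M1 [C1 [M1_gt0 H1]]]] := rep_multiples (fun i => b_gt0 (J + i)).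
(* Arguments can be reduced modulo [2 * M1], so from [B] on at least [C1] is left for the tail. *)
pose B := C1 + \sum_(0 <= i < J) b i * triangular (2 * M1).
have [N HN] : exists N, forall n, n < B -> forall K', N <= K' -> (exists K, rep b 0 K n) -> rep b 0 K' n.
  apply: (eventually_all (Q := fun n K' => (exists K, rep b 0 K n) -> rep b 0 K' n)) => n _.
  have [[K HK]|no] := pselect (exists K, rep b 0 K n); last by exists 0.
  by exists K => K' KK' _; apply: rep_widen HK.
exists (maxn N (J + K1)) => K n Hn.
have [nB|Bn] := ltnP n B; first by apply: (HN n nB); [exact: leq_maxl|exists K].
have [x Ex] : locrep b J M1 n by apply: locrep_of_prime_powers => // p a pp; apply: Hloc pp Hn.
pose A := \sum_(0 <= i < J) b i * triangular (x i %% (2 * M1)).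
have EA : A = n %[mod M1].
  rewrite -Ex; apply: eqmod_sum => i _; apply: eqmodM => //; apply: triangular_mod.
  by rewrite modn_mod.
have AB : A + C1 <= n.
  apply: leq_trans Bn; rewrite /B addnC leq_add2l; apply: leq_sum => i _.
  by rewrite leq_mul2l triangular_homo ?orbT // ltnW // ltn_pmod // muln_gt0 M1_gt0.
have An : A <= n by apply: leq_trans AB; apply: leq_addr.
apply: (@rep_widen _ 0 0 (J + K1)); rewrite ?leq_maxr //.
rewrite -(subnKC An); apply: (@rep_cat _ _ J); first by rewrite leq_addr.
  by exists (fun i => x i %% (2 * M1)).
apply/rep_offset/H1; first by rewrite leq_subRL // addnC.
by rewrite -eqn_mod_dvd //; apply/eqP.
Qed.

(** * Finite certificates *)

(* [g] is a multiset of coefficients; each one is paired with the argument of its triangular number. *)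
Definition reps (g : seq nat) (n : nat) : Prop :=
  exists2 s : seq (nat * nat), perm_eq [seq p.1 | p <- s] g & n = \sum_(p <- s) p.1 * triangular p.2.

Lemma perm_map_lift (T U : eqType) (f : T -> U) (s : seq T) (g : seq U) :
  perm_eq (map f s) g -> exists2 s', perm_eq s s' & map f s' = g.
Proof.
elim: g s => [|c g IH] s E.
  by exists [::]; rewrite // (size0nil (s := s)) // -(size_map f) (perm_size E).
have /mapP[p ps Ec] : c \in map f s by rewrite (perm_mem E) mem_head.
have [|s' ss' <-] := IH (rem p s).
  by rewrite -(perm_cons c) {1}Ec -map_cons (perm_trans _ E) // perm_map // perm_sym perm_to_rem.
exists (p :: s'); last by rewrite /= Ec.
by rewrite (perm_trans (perm_to_rem ps)) // perm_cons.
Qed.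

Lemma perm_reps g g' n : perm_eq g g' -> reps g n -> reps g' n.
Proof. by move=> gg' [s sg ->]; exists s => //; apply: perm_trans gg'. Qed.

Lemma reps_cat g g' n : reps g n -> reps (g ++ g') n.
Proof.
move=> [s sg ->]; exists (s ++ [seq (c, 0) | c <- g']).
  by rewrite map_cat -map_comp map_id perm_cat.
by rewrite big_cat big_map /= [X in _ + X]big1 ?addn0 // => c _; rewrite muln0.
Qed.

Lemma reps_mkseq b K n : reps (mkseq b K) n <-> rep b 0 K n.
Proof.
split=> [[s] | [x ->]].
  move=> /perm_map_lift[s' ss' Es'] ->; exists (fun i => (nth (0, 0) s' i).2).
  have szs : size s' = K by rewrite -(size_map fst) Es' size_mkseq.
  rewrite (perm_big _ ss') /= (big_nth (0, 0)) szs; apply: eq_big_nat => i /andP[_ iK].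
  by rewrite -(nth_map _ 0 fst) ?szs // Es' nth_mkseq.
exists (mkseq (fun i => (b i, x i)) K); first by rewrite -map_comp.
by rewrite /mkseq big_map /index_iota subn0.
Qed.

Lemma reps_represents k (b : k.-tuple nat) n : reps b n <-> represents b n.
Proof.
split=> [[s] | [x ->]].
  move=> /perm_map_lift[s' ss' Es'] ->.
  have szs : size s' == k by rewrite -(size_map fst) Es' size_tuple.
  exists (map_tuple snd (Tuple szs)).
  rewrite (perm_big _ ss') /= -[s']/(val (Tuple szs)) big_tuple; apply: eq_bigr => i _.
  rewrite tnth_map; congr (_ * _); rewrite -(tnth_map fst); congr tnth.
  exact: val_inj.
exists [seq (tnth b i, tnth x i) | i <- enum 'I_k].
  rewrite -map_comp (_ : map _ _ = b) //.
  by rewrite -[RHS]map_tnth_enum.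
by rewrite big_map big_enum.
Qed.

Lemma bounded_seqs k B : exists L : seq (seq nat),
  forall M, size M <= k -> all (fun c => c < B) M -> M \in L.
Proof.
elim: k => [|k [L HL]]; first by exists [:: [::]] => -[].
exists ([::] :: [seq c :: M | c <- iota 0 B, M <- L]) => -[|c M] //= Mk /andP[cB MB].
rewrite inE /=; apply: allpairs_f; last exact: HL.
by rewrite mem_iota.
Qed.

Definition positive (g : seq nat) : Prop := forall c, c \in g -> 0 < c.

(** [M] collects the coefficients of [r] whose terms are nonzero; these terms add up to at most [t],
    which bounds their number and each coefficient. *)
Lemma reps_extension g r t : positive r -> reps (g ++ r) t ->
  exists M r', [/\ perm_eq r (M ++ r'), size M <= t, all (fun c => c < t.+1) M & reps (g ++ M) t].
Proof.
move=> r0 [s] /perm_map_lift[s' ss' Es'] Et.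
pose s1 := take (size g) s'; pose s2 := drop (size g) s'.
have E1 : map fst s1 = g by rewrite /s1 map_take Es' take_size_cat.
have E2 : map fst s2 = r by rewrite /s2 map_drop Es' drop_size_cat.
pose F (p : nat * nat) := p.1 * triangular p.2.
pose P (p : nat * nat) := 0 < F p.
have Es2 : \sum_(p <- s2) F p = \sum_(p <- filter P s2) F p.
  rewrite big_filter [LHS](bigID P) /= [X in _ + X]big1 ?addn0 // => p.
  by rewrite /P -leqNgt leqn0 => /eqP.
have E : t = \sum_(p <- s1) F p + \sum_(p <- filter P s2) F p.
  by rewrite -Es2 -big_cat cat_take_drop Et (perm_big _ ss').
have le2 : \sum_(p <- filter P s2) F p <= t by rewrite [leqRHS]E leq_addl.
exists (map fst (filter P s2)), (map fst (filter (predC P) s2)); split.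
- by rewrite -map_cat -E2 perm_map // perm_sym perm_filterC.
- rewrite size_map; apply: leq_trans le2.
  rewrite -sum1_size big_seq [leqRHS]big_seq; apply: leq_sum => p.
  by rewrite mem_filter => /andP[].
- apply/allP => _ /mapP[p pP ->]; rewrite ltnS; apply: leq_trans le2.
  rewrite (big_rem p pP) /=; apply: leq_trans (leq_addr _ _).
  move: pP; rewrite mem_filter => /andP[Pp _]; move: Pp; rewrite /P /F muln_gt0 => /andP[_ T0].
  exact: leq_pmulr.
- exists (s1 ++ filter P s2); first by rewrite map_cat E1.
  by rewrite big_cat /= E.
Qed.

(** * Endless extension of uncertified multisets *)

Section Truants.
Variable S : set nat.

(* No finite part of [S] certifies that a form containing [g] represents [S]. *)
Definition uncertified (g : seq nat) : Prop :=
  positive g /\ forall S0 : seq nat, (forall n, n \in S0 -> S n) ->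
  exists r, [/\ positive r, forall n, n \in S0 -> reps (g ++ r) n
    & exists2 t, S t & ~ reps (g ++ r) t].

(** Some [t] in [S] is missed by [g], and only finitely many small [M] can be the part of an
    extension that represents it. If each [g ++ M] had a finite certificate, these together with [t]
    would certify [g]. *)
Lemma uncertified_step g : uncertified g ->
  exists M, uncertified (g ++ M) /\ exists t, ~ reps g t /\ reps (g ++ M) t.
Proof.
move=> [g0 Hg].
have [r [r0 _ [t St nt]]] := Hg [::] (fun n => ltac:(by rewrite in_nil)).
have ng : ~ reps g t by move=> Ht; apply: nt; apply: reps_cat.
apply: contrapT => H.
have {}H M : reps (g ++ M) t -> ~ uncertified (g ++ M).
  by move=> Mt Mu; apply: H; exists M; split=> //; exists t.
have Hcert M : exists S0 : seq nat, (forall n, n \in S0 -> S n) /\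
    (reps (g ++ M) t -> positive (g ++ M) -> forall r, positive r ->
      (forall n, n \in S0 -> reps (g ++ M ++ r) n) -> forall n, S n -> reps (g ++ M ++ r) n).
  have [/H Mu|nM] := pselect (reps (g ++ M) t); last by exists [::]; split.
  have [Mp|nMp] := pselect (positive (g ++ M)); last by exists [::]; split.
  apply: contrapT => HM; apply: Mu; split=> // S0 HS0; apply: contrapT => HS.
  apply: HM; exists S0; split=> // _ _ r' r'0 Hr' n Sn; apply: contrapT => nn.
  by apply: HS; exists r'; rewrite -catA; split=> //; exists n.
have /choice [cert Hc] := Hcert.
have [L HL] := bounded_seqs t t.+1.
pose S0 := t :: flatten (map cert L).
have [|r1 [r10 Hr1 [n Sn nn]]] := Hg S0.
- move=> n; rewrite inE => /predU1P[->//|/flatten_mapP[M _]].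
  by have [HM _] := Hc M; apply: HM.
have [M [r' [Er MS Mt Mrep]]] := reps_extension r10 (Hr1 t (mem_head _ _)).
have [_ HcM] := Hc M.
have pE : perm_eq (g ++ r1) (g ++ M ++ r') by rewrite perm_cat2l.
apply: nn; apply: (perm_reps (g := g ++ M ++ r')); first by rewrite perm_sym.
have posr c : c \in M ++ r' -> 0 < c by rewrite -(perm_mem Er); apply: r10.
apply: HcM => //.
- by move=> c; rewrite mem_cat => /orP[/g0//|cM]; apply: posr; rewrite mem_cat cM.
- by move=> c cr; apply: posr; rewrite mem_cat cr orbT.
- move=> m mM; apply: (perm_reps pE); apply: Hr1; rewrite inE; apply/orP; right.
  by apply/flatten_mapP; exists M => //; apply: HL.
Qed.

Lemma uncertified_false g : ~ uncertified g.
Proof.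
move=> gu.
have step g' : exists M, uncertified g' ->
    uncertified (g' ++ M) /\ exists t, ~ reps g' t /\ reps (g' ++ M) t.
  have [/uncertified_step[M HM]|ng] := pselect (uncertified g'); first by exists M.
  by exists [::].
have /choice [ext Hext] := step.
pose G := fix G k := if k is k'.+1 then G k' ++ ext (G k') else g.
have Gu k : uncertified (G k) by elim: k => // k IH; case: (Hext _ IH).
have Gt k : exists t, ~ reps (G k) t /\ reps (G k.+1) t by case: (Hext _ (Gu k)).
have Gsize k : size (G k) < size (G k.+1).
  rewrite /= size_cat -[ltnLHS]addn0 ltn_add2l lt0n size_eq0; apply/eqP => E.
  by have [t [nt]] := Gt k; rewrite /= E cats0.
have Gk k : k <= size (G k) by elim: k => // k IH; apply: leq_ltn_trans (Gsize k).
have Gpre k l : k <= l -> exists r, G l = G k ++ r.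
  elim: l => [|l IH]; first by rewrite leqn0 => /eqP ->; exists [::]; rewrite cats0.
  rewrite leq_eqVlt => /predU1P[->|/IH[r E]]; first by exists [::]; rewrite cats0.
  by exists (r ++ ext (G l)); rewrite /= {1}E catA.
(* [G i.+1] has more than [i] entries and later stages only append, so the default [1] never occurs
   and every [G k] is an initial segment of [b]. *)
pose b i := nth 1 (G i.+1) i.
have b_gt0 i : 0 < b i by apply: (Gu i.+1).1; rewrite mem_nth.
have GE k : G k = mkseq b (size (G k)).
  apply: (@eq_from_nth _ 1); rewrite ?size_mkseq // => i ik; rewrite nth_mkseq // /b.
  have [ki|ik'] := leqP k i.+1.
    by have [r ->] := Gpre _ _ ki; rewrite nth_cat ik.
  by have [r ->] := Gpre _ _ (ltnW ik'); rewrite nth_cat Gk.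
have [N HN] := rep_stable b_gt0.
(* [G N] has at least [N] entries, so it already represents whatever the first [N] coefficients do,
   including the number that stage [N] should miss. *)
have [t [nt]] := Gt N; rewrite GE => /reps_mkseq/HN Ht; apply: nt.
by rewrite GE; apply/reps_mkseq; apply: rep_widen Ht.
Qed.

End Truants.

Local Open Scope classical_set_scope.

Theorem theorem1p2 (S : set nat) (hS : forall n : nat, S n -> 0 < n) :
  exists S0 : set nat,
    [/\ S0 `<=` S,
        finite_set S0
      & forall (k : nat) (b : k.-tuple nat), triangular_form b ->
          (represents_set b S <-> represents_set b S0)].
Proof.
(* Every form extends the empty multiset, which is therefore uncertified when no finite subset
   works. *)
apply: contrapT => H; apply: (@uncertified_false S [::]); split=> // S0 HS0.
apply: contrapT => HS; apply: H; exists [set` S0]; split=> [n /HS0//||k b bf]; first exact: finite_seq.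
split=> [bS n nS0|bS0 n Sn]; first by apply: bS; apply: HS0.
apply/reps_represents; apply: contrapT => nn; apply: HS; exists b; split.
- by move=> c /tnthP[i ->]; case: bf.
- by move=> m mS0; apply/(reps_represents b); apply: bS0.
- by exists n.
Qed.
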